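(* Let $M$ be a $C^\infty$ closed manifold and let $f: M \to M$ be a transitive Anosov endomorphism. Then: (1) either $f$ is a special Anosov endomorphism, (2) or there exists a residual subset $\mathcal{R} \subset M$ such that every $x \in \mathcal{R}$ has infinitely many unstable directions.
   Context: An $f$-orbit is a sequence $(x_n)_{n\in\mathbb{Z}}$ in $M$ with $f(x_n)=x_{n+1}$ for all $n\in\mathbb{Z}$. A $C^1$ local diffeomorphism $f: M\to M$ is an Anosov endomorphism if there are constants $C>0$ and $\lambda>1$ such that for every $f$-orbit $\tilde x=(x_n)_{n\in\mathbb{Z}}$ there is a splitting $T_{x_i}M = E^s_{x_i}\oplus E^u_{x_i}$, $i\in\mathbb{Z}$, preserved by $Df$, such that for all $n>0$ and all $i\in\mathbb{Z}$: $\|Df^n(x_i)v\|\ge C^{-1}\lambda^n\|v\|$ for every $v\in E^u_{x_i}$, and $\|Df^n(x_i)v\|\le C\lambda^{-n}\|v\|$ for every $v\in E^s_{x_i}$. (Here $E^u_{x_i}$ depends in general on the orbit and not only on the point $x_i$.) For an orbit $\tilde x$, write $E^u(\tilde x)\subset T_{x_0}M$ for the unstable subspace at $x_0$ given by this splitting along $\tilde x$. The unstable directions at $x\in M$ are the subspaces $E^u(\tilde x)\subset T_xM$, where $\tilde x$ ranges over all $f$-orbits with $x_0=x$. The Anosov endomorphism $f$ is special if $E^u(\tilde x)$ depends only on $x_0$, i.e. every point $x\in M$ has exactly one unstable direction. Transitive means that there is a point with dense forward orbit. Residual means containing a countable intersection of open dense sets. *)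

(* Defs.v *)
From HB Require Import structures.
From mathcomp Require Import all_boot all_order all_algebra.
From mathcomp Require Import all_classical all_reals all_analysis.

Set Implicit Arguments.
Unset Strict Implicit.
Unset Printing Implicit Defensive.

Import Order.TTheory GRing.Theory Num.Theory.
Import numFieldNormedType.Exports.

Local Open Scope classical_set_scope.
Local Open Scope ring_scope.

(* Meant for U open and V finite-dimensional: then F is C^(k+1) on U iff it is
   differentiable on U and all its directional derivatives are C^k on U. *)
Fixpoint Ck_on (R : realType) (V W : normedModType R) (k : nat) (U : set V)
    (F : V -> W) : Prop :=
  match k with
  | 0 => forall x, U x -> {for x, continuous F}
  | k'.+1 => (forall x, U x -> differentiable F x) /\
             (forall v, Ck_on k' U (fun x => 'D_v F x))
  end.

Definition smooth_on (R : realType) (V W : normedModType R) (U : set V)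
  (F : V -> W) : Prop := forall k, Ck_on k U F.

(* chart_map and chart_inv are total; only their values on chart_dom and on
   chart_map @` chart_dom are meaningful. *)
Record chart (R : realType) (n : nat) (T : topologicalType) := Chart {
  chart_dom : set T;
  chart_map : T -> 'rV[R]_n;
  chart_inv : 'rV[R]_n -> T;
  chart_dom_open : open chart_dom;
  chart_img_open : open (chart_map @` chart_dom);
  chart_mapK : forall x, chart_dom x -> chart_inv (chart_map x) = x;
  chart_map_cont : forall x, chart_dom x -> {for x, continuous chart_map};
  chart_inv_cont :
    forall y, (chart_map @` chart_dom) y -> {for y, continuous chart_inv} }.

(* Second countability follows from compactness and local Euclideanness.
   Connectedness is not assumed. *)
Record closed_manifold (R : realType) (n : nat) := ClosedManifold {
  carrier :> topologicalType;
  atlas : set (chart R n carrier);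
  atlas_cover : forall x : carrier, exists2 c, atlas c & chart_dom c x;
  atlas_smooth : forall c d, atlas c -> atlas d ->
    smooth_on (chart_map c @` (chart_dom c `&` chart_dom d))
              (chart_map d \o chart_inv c);
  carrier_hausdorff : hausdorff_space carrier;
  carrier_compact : compact [set: carrier] }.

Section Manifold.
Context {R : realType} {n : nat} (M : closed_manifold R n).

(* A chosen chart around x. The tangent space T_x M is 'rV[R]_n, a tangent
   vector being given by its coordinates in the chart chart_at x. *)
Definition chart_at (x : M) : chart R n M := s2val (cid2 (atlas_cover x)).

Definition tangent_map (f : M -> M) (x : M) : 'rV[R]_n -> 'rV[R]_n :=
  'd (chart_map (chart_at (f x)) \o f \o chart_inv (chart_at x))
     (chart_map (chart_at x) x).

Definition manifold_Ck_on (k : nat) (U : set M) (f : M -> M) : Prop :=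
  (forall x, U x -> {for x, continuous f}) /\
  (forall c d, atlas c -> atlas d ->
     Ck_on k (chart_map c @` (chart_dom c `&` U `&` f @^-1` chart_dom d))
             (chart_map d \o f \o chart_inv c)).

Definition C1_local_diffeo (f : M -> M) : Prop :=
  forall x : M, exists (U : set M) (g : M -> M),
    [/\ open U, U x, open (f @` U), (forall y, U y -> g (f y) = y) &
        manifold_Ck_on 1 U f /\ manifold_Ck_on 1 (f @` U) g].

(* Coordinates at chart_inv c y of the tangent vector whose coordinates in the
   chart c are v. *)
Definition to_tangent (c : chart R n M) (y v : 'rV[R]_n) : 'rV[R]_n :=
  'd (chart_map (chart_at (chart_inv c y)) \o chart_inv c) y v.

Record riemannian_metric := RiemannianMetric {
  metric :> M -> 'rV[R]_n -> 'rV[R]_n -> R;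
  metric_linear : forall x w a u v,
    metric x (a *: u + v) w = a * metric x u w + metric x v w;
  metric_sym : forall x u v, metric x u v = metric x v u;
  metric_pos : forall x v, v != 0 -> 0 < metric x v v;
  metric_smooth : forall c, atlas c -> forall v w : 'rV[R]_n,
    smooth_on (chart_map c @` chart_dom c)
      (fun y => metric (chart_inv c y) (to_tangent c y v) (to_tangent c y w)) }.

Definition tangent_norm (g : riemannian_metric) (x : M) (v : 'rV[R]_n) : R :=
  Num.sqrt (g x v v).

Definition is_orbit (f : M -> M) (xs : int -> M) : Prop :=
  forall i : int, f (xs i) = xs (i + 1).

Record hyperbolic_splitting (g : riemannian_metric) (f : M -> M) (C lam : R)
    (xs : int -> M) (Es Eu : int -> {vspace 'rV[R]_n}) : Prop := {
  splitting_direct : forall i,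
    (Es i + Eu i)%VS = fullv /\ (Es i :&: Eu i)%VS = 0%VS;
  splitting_s_invariant : forall i,
    (linfun (tangent_map f (xs i)) @: Es i)%VS = Es (i + 1);
  splitting_u_invariant : forall i,
    (linfun (tangent_map f (xs i)) @: Eu i)%VS = Eu (i + 1);
  splitting_expands : forall (k : nat) (i : int) v, (0 < k)%N -> v \in Eu i ->
    C^-1 * lam ^+ k * tangent_norm g (xs i) v <=
      tangent_norm g (iter k f (xs i)) (tangent_map (iter k f) (xs i) v);
  splitting_contracts : forall (k : nat) (i : int) v, (0 < k)%N -> v \in Es i ->
    tangent_norm g (iter k f (xs i)) (tangent_map (iter k f) (xs i) v) <=
      C * lam ^- k * tangent_norm g (xs i) v }.

Definition anosov_endomorphism (g : riemannian_metric) (f : M -> M) : Prop :=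
  C1_local_diffeo f /\
  exists C lam : R, [/\ 0 < C, 1 < lam &
    forall xs, is_orbit f xs ->
      exists Es Eu, hyperbolic_splitting g f C lam xs Es Eu].

(* E is E^u(xs). The splitting along an orbit is unique, whatever its
   constants, so that this relation is functional in xs. *)
Definition unstable_subspace (g : riemannian_metric) (f : M -> M)
    (xs : int -> M) (E : {vspace 'rV[R]_n}) : Prop :=
  exists C lam : R, [/\ 0 < C, 1 < lam &
    exists Es Eu, hyperbolic_splitting g f C lam xs Es Eu /\ Eu 0 = E].

Definition unstable_directions (g : riemannian_metric) (f : M -> M) (x : M) :
    set {vspace 'rV[R]_n} :=
  [set E | exists xs, [/\ is_orbit f xs, xs 0 = x & unstable_subspace g f xs E]].

(* E^u(xs) depends only on xs 0. See special_unique_direction for the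
   formulation with exactly one unstable direction. *)
Definition special (g : riemannian_metric) (f : M -> M) : Prop :=
  forall xs ys, is_orbit f xs -> is_orbit f ys -> xs 0 = ys 0 ->
  forall E F, unstable_subspace g f xs E -> unstable_subspace g f ys F -> E = F.

Definition transitive_map (f : M -> M) : Prop :=
  exists x : M, dense [set iter k f x | k in [set: nat]].

Definition residual (A : set M) : Prop :=
  exists U : nat -> set M,
    (forall k, open (U k) /\ dense (U k)) /\ \bigcap_k U k `<=` A.

Lemma surjective_orbit (f : M -> M) (x : M) :
  (forall y, exists z, f z = y) -> exists2 xs, is_orbit f xs & xs 0 = x.
Proof.
move=> /choice[h hK].
exists (fun i : int => match i with Posz k => iter k f x
                                  | Negz k => iter k.+1 h x end) => //.
case=> [k|[|k]]; first by rewrite -PoszD addn1.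
  by rewrite /= hK.
have -> : Negz k.+1 + 1 = Negz k by rewrite !NegzE -addn1 PoszD opprD addrNK.
by rewrite /= hK.
Qed.

Lemma special_unique_direction (g : riemannian_metric) (f : M -> M) :
  (forall y, exists z, f z = y) -> anosov_endomorphism g f ->
  special g f <-> forall x, exists! E, unstable_directions g f x E.
Proof.
move=> fsurj [_ [C [lam [C0 lam1 split]]]]; split=> [spec x|uniq].
  have [xs oxs xs0] := surjective_orbit x fsurj.
  have [Es [Eu EsEu]] := split _ oxs.
  have uE : unstable_subspace g f xs (Eu 0).
    by exists C, lam; split=> //; exists Es, Eu.
  exists (Eu 0); split; first by exists xs.
  move=> F [ys [oys ys0 uF]].
  by apply: (spec xs ys) => //; rewrite xs0 ys0.
move=> xs ys oxs oys xys E F uE uF.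
have [D [_ DP]] := uniq (xs 0).
have <- : D = E by apply: DP; exists xs.
by apply: DP; exists ys; rewrite xys.
Qed.

End Manifold.

(* Main.v *)
(* A point x has k unstable directions when k orbits through x have pairwise
   distinct unstable spaces. The unstable space depends continuously on the whole
   orbit, and the past of an orbit through x can be followed, along inverse
   branches of f, by pasts of orbits through all points near x; so having k
   directions is an open condition. It is preserved by f since Df is injective,
   hence it holds on a dense set as soon as it holds somewhere, by transitivity.

   If it holds somewhere for some k > 1, it holds somewhere for k + 1. Let p have
   k directions. Points z arbitrarily close to p have k directions close to those
   of p, and z = f^j w where w itself has k directions, with j arbitrarily large.
   The k directions at z pushed from w come from orbits with a common past of
   length j, so they collapse to a single direction as j grows and z tends to p,
   and they cannot all coincide with the former ones.

   Continuity of the unstable space is obtained without topologizing the set of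
   subspaces: if v is unstable along an orbit, a long backward iterate contracts
   it, and still does so along nearby orbits, which forces its stable component
   there to be small. *)
From HB Require Import structures.
From mathcomp Require Import all_boot all_order all_algebra.
From mathcomp Require Import all_classical all_reals all_analysis.
From mathcomp Require Import ring lra.
Require Import Defs.

Set Implicit Arguments.
Unset Strict Implicit.
Unset Printing Implicit Defensive.

Import Order.TTheory GRing.Theory Num.Theory.
Import numFieldNormedType.Exports.

Local Open Scope classical_set_scope.
Local Open Scope ring_scope.

(** * Limits and derivatives in coordinates *)

Lemma near_eq_continuous_at (T U : topologicalType) (f g : T -> U) (x : T) :
  (\forall y \near x, f y = g y) -> f @ x --> f x -> g @ x --> g x.
Proof.
move=> fg; rewrite -(nbhs_singleton fg) => fx; apply: cvg_trans fx.
exact: near_eq_cvg.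
Qed.

Lemma near_eq_differentiable (R : realType) (V W : normedModType R)
    (F G : V -> W) (x : V) :
  {near x, F =1 G} -> differentiable F x -> differentiable G x.
Proof.
move=> FG dF; have dFc : continuous ('d F x) by exact: diff_continuous.
(* A first-order expansion of [G] with linear part ['d F x] determines ['d G x], by uniqueness of
   the differential. *)
suff dG : G \o shift x = cst (G x) + 'd F x +o_ 0 id.
  have GF : 'd G x = 'd F x :> (V -> W) by exact: diff_unique.
  by apply/diff_locallyP; split; rewrite GF.
apply/eqaddoP => e e0; have /eqaddoP/(_ _ e0) := diff_locally dF.
have Gx : G x = F x by rewrite (nbhs_singleton FG).
have FG0 : \forall h \near (0 : V), F (h + x) = G (h + x).
  by move: FG; rewrite (near_shift 0 x) /= subr0.
by apply: filterS2 FG0 => h /= FGh; rewrite !fctE /= FGh Gx.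
Qed.

Lemma near_eq_diff (R : realType) (V W : normedModType R)
    (F G : V -> W) (x v : V) :
  {near x, F =1 G} -> differentiable F x -> 'd F x v = 'd G x v.
Proof.
move=> FG dF; rewrite -!deriveE //; first exact: near_eq_derive.
exact: near_eq_differentiable FG dF.
Qed.

Lemma cvg_coord (R : realType) (m n : nat) (A : 'M[R]_(m, n)) i j :
  (fun B : 'M[R]_(m, n) => B i j) @ A --> A i j.
Proof. exact: coord_continuous. Qed.

Lemma cvg_sum (R : realType) (V : normedModType R) (T : Type) (m : nat)
    (F : set_system T) (h : 'I_m -> T -> V) (l : 'I_m -> V) :
  Filter F -> (forall j, h j @ F --> l j) ->
  \sum_(j < m) h j t @[t --> F] --> \sum_(j < m) l j.
Proof.
move=> FF; elim: m h l => [|m IH] h l hl.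
  by rewrite big_ord0; under eq_fun do rewrite big_ord0; exact: cvg_cst.
rewrite big_ord_recl; under eq_fun do rewrite big_ord_recl.
by apply: cvgD => //; apply: IH.
Qed.

(** Expanding in the standard basis leaves finitely many coefficients, so in finite dimension
    pointwise convergence of the linear maps suffices even though the argument moves too. *)
Lemma cvg_linear_apply (R : realType) (m n : nat) (T : Type)
    (F : set_system T) (L : T -> {linear 'rV[R]_m -> 'rV[R]_n})
    (L0 : {linear 'rV[R]_m -> 'rV[R]_n}) (w : T -> 'rV[R]_m) (w0 : 'rV[R]_m) :
  Filter F -> (forall v, L t v @[t --> F] --> L0 v) -> w @ F --> w0 ->
  L t (w t) @[t --> F] --> L0 w0.
Proof.
move=> FF LL0 ww0.
have E (K : {linear 'rV[R]_m -> 'rV[R]_n}) v :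
    K v = \sum_(j < m) v 0 j *: K (delta_mx 0 j).
  rewrite {1}(row_sum_delta v) linear_sum; apply: eq_bigr => j _.
  by rewrite linearZ.
rewrite E; under eq_fun do rewrite E.
apply: (@cvg_sum _ _ _ _ _ (fun j t => w t 0 j *: L t (delta_mx 0 j))
  (fun j => w0 0 j *: L0 (delta_mx 0 j)) FF) => j.
apply: cvgZ; last exact: LL0.
exact: (cvg_comp _ _ ww0 (@cvg_coord _ _ _ w0 0 j)).
Qed.

(** The same expansion in both arguments; it serves for the metric, whose coefficients converge
    entrywise. *)
Lemma cvg_bilinear_apply (R : realType) (n : nat) (T : Type)
    (F : set_system T) (b : T -> 'rV[R]_n -> 'rV[R]_n -> R)
    (b0 : 'rV[R]_n -> 'rV[R]_n -> R) (w : T -> 'rV[R]_n) (w0 : 'rV[R]_n) :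
  Filter F ->
  (\forall t \near F, (forall u, linear (b t u : 'rV[R]_n -> R^o)) /\
     (forall u, linear ((b t)^~ u : 'rV[R]_n -> R^o))) ->
  (forall u, linear (b0 u : 'rV[R]_n -> R^o)) ->
  (forall u, linear (b0^~ u : 'rV[R]_n -> R^o)) ->
  (forall u v, b t u v @[t --> F] --> b0 u v) -> w @ F --> w0 ->
  b t (w t) (w t) @[t --> F] --> b0 w0 w0.
Proof.
move=> FF bl b0l b0r bb0 ww0.
have lE (h : 'rV[R]_n -> R^o) v : linear h ->
    h v = \sum_(j < n) v 0 j * h (delta_mx 0 j).
  move=> hl; pose H : {linear 'rV[R]_n -> R^o} :=
    HB.pack h (GRing.isLinear.Build _ _ _ _ h hl).
  rewrite -[h]/(H : _ -> _) {1}(row_sum_delta v) linear_sum.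
  by apply: eq_bigr => j _; rewrite linearZ.
have E (c : 'rV[R]_n -> 'rV[R]_n -> R) v :
    (forall u, linear (c u : 'rV[R]_n -> R^o)) ->
    (forall u, linear (c^~ u : 'rV[R]_n -> R^o)) ->
    c v v = \sum_(j < n) v 0 j *
              \sum_(k < n) v 0 k * c (delta_mx 0 k) (delta_mx 0 j).
  move=> cl cr; rewrite (lE (c v)) //; apply: eq_bigr => j _; congr (_ * _).
  exact: (lE (c^~ _)).
rewrite E //.
have coord j : w t 0 j @[t --> F] --> w0 0 j.
  exact: (cvg_comp _ _ ww0 (@cvg_coord _ _ _ w0 0 j)).
have C : \sum_(j < n) w t 0 j *
              \sum_(k < n) w t 0 k * b t (delta_mx 0 k) (delta_mx 0 j)
    @[t --> F] --> \sum_(j < n) w0 0 j *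
              \sum_(k < n) w0 0 k * b0 (delta_mx 0 k) (delta_mx 0 j).
  apply: (@cvg_sum R R^o _ _ _ (fun j t => w t 0 j * _) (fun j => w0 0 j * _)
    FF) => j.
  apply: cvgM => //.
  by apply: (@cvg_sum R R^o _ _ _ (fun k t => w t 0 k * _)
    (fun k => w0 0 k * _) FF) => k; apply: cvgM.
apply: cvg_trans C; apply: near_eq_cvg; near=> t.
apply/esym; have [|tl tr] := near bl t; first by [].
exact: E.
Unshelve. all: by end_near. Qed.

(** * C1 maps in charts *)

Section C1Maps.
Context {R : realType} {n : nat} (M : closed_manifold R n).
Implicit Types (F G : M -> M) (c d e : chart R n M) (x y : M).

Definition chart_rep F c d : 'rV[R]_n -> 'rV[R]_n :=
  chart_map d \o F \o chart_inv c.

(** Continuity is a separate clause: [chart_map d] is total, with meaningless values off its domain,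
    so differentiability in coordinates does not by itself keep [F] inside [chart_dom d]. *)
Definition differentiable_at F x : Prop :=
  {for x, continuous F} /\
  forall c d, atlas c -> atlas d -> chart_dom c x -> chart_dom d (F x) ->
    differentiable (chart_rep F c d) (chart_map c x).

(** Stated at a single point, so that composites and germs need no bookkeeping of open domains. *)
Definition C1_at F x : Prop :=
  (\forall y \near x, differentiable_at F y) /\
  forall c d, atlas c -> atlas d -> chart_dom c x -> chart_dom d (F x) ->
    forall v, 'd (chart_rep F c d) (chart_map c y) v @[y --> x] -->
              'd (chart_rep F c d) (chart_map c x) v.

Lemma chart_at_atlas x : atlas (chart_at x).
Proof. by rewrite /chart_at; case: cid2. Qed.

Lemma chart_at_dom x : chart_dom (chart_at x) x.
Proof. by rewrite /chart_at; case: cid2. Qed.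

Lemma near_chart_dom c x : chart_dom c x -> \forall y \near x, chart_dom c y.
Proof. by move=> cx; apply: open_nbhs_nbhs; split=> //; exact: chart_dom_open. Qed.

Lemma near_chart_img c x : chart_dom c x ->
  \forall v \near chart_map c x,
    chart_dom c (chart_inv c v) /\ chart_map c (chart_inv c v) = v.
Proof.
move=> cx; have : nbhs (chart_map c x) (chart_map c @` chart_dom c).
  by apply: open_nbhs_nbhs; split; [exact: chart_img_open|exists x].
by apply: filterS => _ [y cy <-]; rewrite chart_mapK.
Qed.

Lemma near_chart_inv c x (P : set M) : chart_dom c x ->
  (\forall y \near x, P y) -> \forall v \near chart_map c x, P (chart_inv c v).
Proof.
move=> cx Px; have := @chart_inv_cont _ _ _ c (chart_map c x).
move=> /(_ (ex_intro2 _ _ x cx erefl)); apply.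
by rewrite /= chart_mapK.
Qed.

Lemma near_eq_chart_rep F G c d x : chart_dom c x -> {near x, F =1 G} ->
  {near chart_map c x, chart_rep F c d =1 chart_rep G c d}.
Proof.
move=> cx /(near_chart_inv cx); apply: filterS => v /= FG.
by rewrite /chart_rep /= FG.
Qed.

Lemma near_chart_rep_comp F G c e d x : {for x, continuous F} ->
  chart_dom c x -> chart_dom e (F x) ->
  {near chart_map c x, chart_rep (G \o F) c d =1
                       chart_rep G e d \o chart_rep F c e}.
Proof.
move=> cF cx eFx; have : \forall y \near x, chart_dom e (F y).
  by apply: cF; exact: near_chart_dom.
move=> /(near_chart_inv cx); apply: filterS => v /= ev.
by rewrite /chart_rep /= chart_mapK.
Qed.

Lemma chart_rep_at F c d x : chart_dom c x ->
  chart_rep F c d (chart_map c x) = chart_map d (F x).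
Proof. by move=> cx; rewrite /chart_rep /= chart_mapK. Qed.

Lemma differentiable_at_comp F G x : differentiable_at F x ->
  differentiable_at G (F x) -> differentiable_at (G \o F) x.
Proof.
move=> [cF dF] [cG dG]; split; first exact: continuous_comp.
move=> c d ac ad cx dx.
have eFx := chart_at_dom (F x); have ae := chart_at_atlas (F x).
apply: near_eq_differentiable.
  have := near_chart_rep_comp G d cF cx eFx.
  by apply: filterS => v; exact: esym.
apply: differentiable_comp; first exact: dF.
by rewrite chart_rep_at //; exact: dG.
Qed.

Lemma diff_chart_rep_comp F G c e d x v : differentiable_at F x ->
  differentiable_at G (F x) -> atlas c -> atlas e -> atlas d ->
  chart_dom c x -> chart_dom e (F x) -> chart_dom d (G (F x)) ->
  'd (chart_rep (G \o F) c d) (chart_map c x) v =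
  'd (chart_rep G e d) (chart_map e (F x))
     ('d (chart_rep F c e) (chart_map c x) v).
Proof.
move=> DF DG ac ae ad cx ex dx.
have E := near_chart_rep_comp G d DF.1 cx ex.
have dGF := (differentiable_at_comp DF DG).2 _ _ ac ad cx dx.
transitivity ('d (chart_rep G e d \o chart_rep F c e) (chart_map c x) v).
  exact: near_eq_diff E dGF.
have dF := DF.2 _ _ ac ae cx ex.
have <- : chart_rep F c e (chart_map c x) = chart_map e (F x).
  exact: chart_rep_at.
have dG : differentiable (chart_rep G e d) (chart_rep F c e (chart_map c x)).
  by rewrite chart_rep_at //; exact: DG.2.
exact: (congr1 (@^~ v) (diff_comp dF dG)).
Qed.

Lemma near_eq_differentiable_at F G x : {near x, F =1 G} ->
  differentiable_at F x -> differentiable_at G x.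
Proof.
move=> FG [cF dF]; have FGx := nbhs_singleton FG; split.
  change (G @ x --> G x); rewrite -FGx; apply: cvg_trans cF.
  by apply: near_eq_cvg.
move=> c d ac ad cx; rewrite -FGx => dx.
by apply: near_eq_differentiable (dF c d ac ad cx dx); exact: near_eq_chart_rep.
Qed.

Lemma near_eq_C1_at F G x : {near x, F =1 G} -> C1_at F x -> C1_at G x.
Proof.
move=> FG [dF cF]; have FGx := nbhs_singleton FG; split.
  near=> y; apply: (near_eq_differentiable_at (F := F)); last by near: y.
  by near: y; exact/near_join.
move=> c d ac ad cx; rewrite -FGx => dx v.
have e : \forall y \near x, 'd (chart_rep F c d) (chart_map c y) v =
                            'd (chart_rep G c d) (chart_map c y) v.
  have FG' : \forall y \near x, {near y, F =1 G} by exact/near_join.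
  have dx' : \forall y \near x, chart_dom d (F y).
    by apply: (nbhs_singleton dF).1; exact: near_chart_dom.
  near=> y.
  have cy : chart_dom c y by near: y; exact: near_chart_dom.
  have dy : chart_dom d (F y) by near: y.
  have Dy : differentiable_at F y by near: y.
  by apply: near_eq_diff (Dy.2 _ _ ac ad cy dy); apply: near_eq_chart_rep => //;
    near: y.
exact: near_eq_continuous_at e (cF c d ac ad cx dx v).
Unshelve. all: by end_near. Qed.

Lemma C1_at_comp F G x : C1_at F x -> C1_at G (F x) -> C1_at (G \o F) x.
Proof.
move=> [dF cF] [dG cG]; have contF := (nbhs_singleton dF).1.
have dGF : \forall y \near x, differentiable_at G (F y) by exact: contF.
split; first by apply: filterS2 dGF dF => y ? ?; exact: differentiable_at_comp.
move=> c d ac ad cx dx v.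
have ex := chart_at_dom (F x); have ae := chart_at_atlas (F x).
set e := chart_at (F x) in ex ae.
have exy : \forall y \near x, chart_dom e (F y) by apply: contF; exact: near_chart_dom.
have dxy : \forall y \near x, chart_dom d (G (F y)).
  exact: (contF _ ((nbhs_singleton dG).1 _ (near_chart_dom dx))).
have cxy := near_chart_dom cx.
have E : \forall y \near x,
  'd (chart_rep (G \o F) c d) (chart_map c y) v =
  'd (chart_rep G e d) (chart_map e (F y))
     ('d (chart_rep F c e) (chart_map c y) v).
  by near=> y; apply: diff_chart_rep_comp => //; near: y.
apply: near_eq_continuous_at (filterS _ E) _; first by move=> y; exact: esym.
apply: (cvg_linear_apply (L := fun y => 'd (chart_rep G e d) (chart_map e (F y)))).
  move=> w; exact: (cvg_comp _ _ contF (cG e d ae ad ex dx w)).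
exact: cF.
Unshelve. all: by end_near. Qed.

Lemma manifold_C1_at F (W : set M) x : open W -> W x -> manifold_Ck_on 1 W F ->
  C1_at F x.
Proof.
move=> oW Wx [cF dF].
have dW y : W y -> differentiable_at F y.
  move=> Wy; split; first exact: cF.
  move=> c d ac ad cy dy; apply: (dF c d ac ad).1.
  by exists y.
split; first by apply: filterS (open_nbhs_nbhs (conj oW Wx)).
move=> c d ac ad cx dx v.
have nx : \forall y \near x, W y /\ chart_dom c y /\ chart_dom d (F y).
  have ? := near_chart_dom cx.
  have ? : \forall y \near x, chart_dom d (F y).
    by apply: (cF _ Wx); exact: near_chart_dom.
  have ? := open_nbhs_nbhs (conj oW Wx).
  by near=> y; split; [|split]; near: y.
have E : \forall y \near x, 'D_v (chart_rep F c d) (chart_map c y) =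
    'd (chart_rep F c d) (chart_map c y) v.
  apply: filterS nx => y [Wy [cy dy]]; apply: deriveE.
  exact: (dW _ Wy).2.
apply: near_eq_continuous_at E _.
have C : {for chart_map c x, continuous (fun w => 'D_v (chart_rep F c d) w)}.
  by apply: (dF c d ac ad).2; exists x.
exact: (cvg_comp _ _ (chart_map_cont cx) C).
Unshelve. all: by end_near. Qed.

(** In charts the identity is a transition map, which the atlas makes smooth. *)
Lemma C1_at_id x : C1_at id x.
Proof.
apply: (@manifold_C1_at _ setT) => //; first exact: openT.
split=> [y _|c d ac ad]; first exact: cvg_id.
have := atlas_smooth ac ad 1%N.
suff -> : chart_dom c `&` setT `&` id @^-1` chart_dom d =
          chart_dom c `&` chart_dom d by [].
by rewrite setIT.
Qed.

End C1Maps.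

(** * Tangent maps and the Riemannian norm *)

Section TangentMaps.
Context {R : realType} {n : nat} (M : closed_manifold R n).
Implicit Types (F G : M -> M) (x y : M).

Lemma tangent_mapD F x u v :
  tangent_map F x (u + v) = tangent_map F x u + tangent_map F x v.
Proof. exact: linearD. Qed.

Lemma tangent_map_comp F G x v : differentiable_at F x ->
  differentiable_at G (F x) ->
  tangent_map (G \o F) x v = tangent_map G (F x) (tangent_map F x v).
Proof.
move=> dF dG; apply: (diff_chart_rep_comp _ dF dG) => //;
  by [exact: chart_at_atlas|exact: chart_at_dom].
Qed.

Lemma near_eq_tangent_map F G x v : {near x, F =1 G} -> differentiable_at F x ->
  tangent_map F x v = tangent_map G x v.
Proof.
move=> FG [_ dF]; have FGx : F x = G x := nbhs_singleton FG.
have E := near_eq_chart_rep (chart_at (F x)) (chart_at_dom x) FG.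
rewrite /tangent_map -FGx; apply: (near_eq_diff _ E); apply: dF;
  by [exact: chart_at_atlas|exact: chart_at_dom].
Qed.

Lemma diff_chart_rep_id (c : chart R n M) x v : chart_dom c x ->
  'd (chart_rep id c c) (chart_map c x) v = v.
Proof.
move=> cx; have E : {near chart_map c x, id =1 chart_rep id c c}.
  by apply: filterS (near_chart_img cx) => w [_ h]; rewrite /chart_rep /= h.
have [dI vI] := is_diff_id (chart_map c x).
transitivity ('d (@id 'rV[R]_n) (chart_map c x) v).
  by apply/esym/(near_eq_diff _ E).
exact: (congr1 (@^~ v) vI).
Qed.

Lemma tangent_map_id x v : tangent_map id x v = v.
Proof. exact: diff_chart_rep_id (chart_at_dom x). Qed.

(* Carries the coordinates of a tangent vector at y from the chart around x to
   the chart around y; near x this makes a constant coordinate vector into a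
   continuous vector field. *)
Definition chart_transport x y : 'rV[R]_n -> 'rV[R]_n :=
  'd (chart_rep id (chart_at x) (chart_at y)) (chart_map (chart_at x) y).

Lemma chart_transport_id x v : chart_transport x x v = v.
Proof. exact: diff_chart_rep_id (chart_at_dom x). Qed.

Lemma chart_transportD x y u v :
  chart_transport x y (u + v) = chart_transport x y u + chart_transport x y v.
Proof. exact: linearD. Qed.

Lemma to_tangentE (c : chart R n M) x v : chart_dom c x ->
  to_tangent c (chart_map c x) v =
  'd (chart_rep id c (chart_at x)) (chart_map c x) v.
Proof. by move=> cx; rewrite /to_tangent chart_mapK. Qed.

Context (g : riemannian_metric M).

Lemma metricDl x u v w : g x (u + v) w = g x u w + g x v w.
Proof. by have := metric_linear g x w 1 u v; rewrite scale1r mul1r. Qed.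

Lemma metric0l x w : g x 0 w = 0.
Proof. by have := metricDl x 0 0 w; rewrite addr0; lra. Qed.

Lemma metricZl x a u w : g x (a *: u) w = a * g x u w.
Proof. by have := metric_linear g x w a u 0; rewrite metric0l !addr0. Qed.

Lemma metricDr x u v w : g x w (u + v) = g x w u + g x w v.
Proof. by rewrite !(metric_sym g x w) metricDl. Qed.

Lemma metricZr x a u w : g x w (a *: u) = a * g x w u.
Proof. by rewrite !(metric_sym g x w) metricZl. Qed.

Lemma metric_ge0 x v : 0 <= g x v v.
Proof.
have [->|v0] := eqVneq v 0; first by rewrite metric0l.
exact/ltW/metric_pos.
Qed.

Lemma metric_cauchy_schwarz x u v : g x u v ^+ 2 <= g x u u * g x v v.
Proof.
have [->|v0] := eqVneq v 0.
  by rewrite (metric_sym g x u) !metric0l expr0n /= mulr0.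
have vv := metric_pos g x v0.
(* This square expands to [g x v v] times the difference of the two sides. *)
have := metric_ge0 x (g x v v *: u + (- g x u v) *: v).
rewrite !metricDl !metricDr !metricZl !metricZr (metric_sym g x v u) => h.
rewrite -subr_ge0 -(pmulr_rge0 _ vv) (le_trans h) // le_eqVlt; apply/orP; left.
by apply/eqP; ring.
Qed.

Lemma tangent_norm_ge0 x v : 0 <= tangent_norm g x v.
Proof. exact: sqrtr_ge0. Qed.

Lemma sqr_tangent_norm x v : tangent_norm g x v ^+ 2 = g x v v.
Proof. by rewrite sqr_sqrtr // metric_ge0. Qed.

Lemma tangent_norm0_eq0 x v : tangent_norm g x v = 0 -> v = 0.
Proof.
move=> h; apply/eqP/negP => /negP v0; have := metric_pos g x v0.
by rewrite -sqr_tangent_norm h expr0n ltxx.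
Qed.

Lemma tangent_normD x u v :
  tangent_norm g x (u + v) <= tangent_norm g x u + tangent_norm g x v.
Proof.
have u0 := tangent_norm_ge0 x u; have v0 := tangent_norm_ge0 x v.
rewrite -(@ler_pXn2r _ 2) ?nnegrE ?addr_ge0 ?tangent_norm_ge0 //.
rewrite sqrrD !sqr_tangent_norm !metricDl !metricDr (metric_sym g x v u).
have h : g x u v <= tangent_norm g x u * tangent_norm g x v.
  apply: le_trans (ler_norm _) _.
  rewrite -(@ler_pXn2r _ 2) ?nnegrE ?mulr_ge0 // exprMn !sqr_tangent_norm.
  by rewrite real_normK ?num_real // metric_cauchy_schwarz.
by rewrite mulr2n; lra.
Qed.

Lemma tangent_normN x v : tangent_norm g x (- v) = tangent_norm g x v.
Proof.
by rewrite /tangent_norm -scaleN1r metricZl metricZr !mulN1r opprK.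
Qed.

Lemma tangent_normB x u v :
  tangent_norm g x (u - v) <= tangent_norm g x u + tangent_norm g x v.
Proof. by rewrite -(tangent_normN x v) tangent_normD. Qed.

(** The charts used by [tangent_map F y] may jump with [y]. The norm is therefore computed in two
    fixed charts, around [x] and around [F x], where the derivative and the coefficients of the
    metric are continuous. *)
Lemma cvg_tangent_norm F x v : C1_at F x ->
  tangent_norm g (F y) (tangent_map F y (chart_transport x y v)) @[y --> x] -->
  tangent_norm g (F x) (tangent_map F x v).
Proof.
move=> [dF cF]; have contF := (nbhs_singleton dF).1.
have cx := chart_at_dom x; have ac := chart_at_atlas x.
have dx := chart_at_dom (F x); have ad := chart_at_atlas (F x).
set c := chart_at x in cx ac; set d := chart_at (F x) in dx ad.
pose T y : {linear 'rV[R]_n -> 'rV[R]_n} :=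
  'd (chart_rep id d (chart_at (F y))) (chart_map d (F y)).
pose w y := 'd (chart_rep F c d) (chart_map c y) v.
pose b y u1 u2 := g (F y) (T y u1) (T y u2).
have dy : \forall y \near x, chart_dom d (F y) by apply: contF; exact: near_chart_dom.
have cy := near_chart_dom cx.
have C : Num.sqrt (b y (w y) (w y)) @[y --> x] --> Num.sqrt (b x (w x) (w x)).
  have sc : {for b x (w x) (w x), continuous (@Num.sqrt R)} by exact: sqrt_continuous.
  apply: (cvg_comp (fun y => b y (w y) (w y)) (@Num.sqrt R) _ sc).
  have bl y u : linear (b y u : _ -> R^o).
    by move=> a u1 u2; rewrite /b linearP metricDr metricZr.
  have br y u : linear ((b y)^~ u : _ -> R^o).
    by move=> a u1 u2; rewrite /b linearP metricDl metricZl.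
  apply: (cvg_bilinear_apply (b := b)) => //; first by apply: nearW.
  - move=> u1 u2.
    pose B q := g (chart_inv d q) (to_tangent d q u1) (to_tangent d q u2).
    have BE : \forall y \near x, B (chart_map d (F y)) = b y u1 u2.
      by apply: filterS dy => y dFy; rewrite /B !to_tangentE // chart_mapK.
    apply: near_eq_continuous_at BE _.
    have Bc : {for chart_map d (F x), continuous B}.
      by apply: (metric_smooth g ad u1 u2 0); exists (F x).
    apply: (cvg_comp (chart_map d \o F) B _ Bc).
    exact: (cvg_comp _ _ contF (chart_map_cont dx)).
  - exact: cF.
have E : \forall y \near x, Num.sqrt (b y (w y) (w y)) =
    tangent_norm g (F y) (tangent_map F y (chart_transport x y v)).
  near=> y; have dFy : differentiable_at F y by near: y.
  have cy' : chart_dom c y by near: y.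
  have dy' : chart_dom d (F y) by near: y.
  have did z : differentiable_at id z by exact: nbhs_singleton (C1_at_id z).1.
  rewrite /b /tangent_norm.
  suff -> : T y (w y) = tangent_map F y (chart_transport x y v) by [].
  have ay := chart_at_atlas y; have yy := chart_at_dom y.
  have aFy := chart_at_atlas (F y); have Fyy := chart_at_dom (F y).
  (* By the chain rule both sides are the derivative of [F] from the chart [c] to the chart around
     [F y]. *)
  transitivity ('d (chart_rep F c (chart_at (F y))) (chart_map c y) v).
    apply: esym.
  exact: (@diff_chart_rep_comp _ _ _ F id c d (chart_at (F y)) y v).
  exact: (@diff_chart_rep_comp _ _ _ id F c (chart_at y) (chart_at (F y)) y v).
have := near_eq_continuous_at E C.
by rewrite [chart_transport x x v]chart_transport_id.
Unshelve. all: by end_near. Qed.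

End TangentMaps.

(** * Hyperbolic splittings *)

Lemma addzS (i : int) (k : nat) : i + k.+1%:Z = i + k%:Z + 1.
Proof. by rewrite -addn1 PoszD addrA. Qed.

Lemma exists_expV_le (R : realType) (C lam e : R) : 0 < C -> 1 < lam -> 0 < e ->
  exists k : nat, (0 < k)%N /\ C * lam ^- k <= e.
Proof.
move=> C0 lam1 e0; have lam0 : 0 < lam by exact: lt_trans lam1.
have h : `|lam^-1| < 1 by rewrite gtr0_norm ?invr_gt0 // invf_lt1.
have eC : 0 < e / C by rewrite divr_gt0.
have /cvgr0Pnorm_lt/(_ _ eC) [N _ HN] := cvg_expr h.
exists N.+1; split=> //; have := HN N.+1 (leqnSn N).
rewrite /= gtr0_norm ?exprn_gt0 ?invr_gt0 // => /ltW.
by rewrite exprVn ler_pdivlMr // mulrC.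
Qed.

Lemma exists_expV_sqr_le (R : realType) (C lam a e : R) :
  0 < C -> 1 < lam -> 0 <= a -> 0 < e ->
  exists k : nat, [/\ (0 < k)%N, (C * lam ^- k) ^+ 2 <= 1 / 2 &
    4 * (C * lam ^- k) ^+ 2 * a <= e].
Proof.
move=> C0 lam1 a0 e0; have lam0 : 0 < lam by exact: lt_trans lam1.
(* If [q <= m] then [q ^+ 2 <= 1 / 4] and [4 q^2 a <= 4 q (a + 1) <= e]; the [+ 1] covers
   [a = 0]. *)
set m := Num.min (1 / 2) (e / (4 * (a + 1))).
have a1 : 0 < 4 * (a + 1) by lra.
have m0 : 0 < m by rewrite lt_min divr_gt0 //= divr_gt0.
have [k [k0 Hk]] := exists_expV_le C0 lam1 m0; exists k; move: Hk.
have : 0 < C * lam ^- k by rewrite mulr_gt0 // invr_gt0 exprn_gt0.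
set q := C * lam ^- k => q0; rewrite le_min => /andP[q2].
rewrite ler_pdivlMr // => qe.
by split=> //; nra.
Qed.

(* L plays the role of a derivative which contracts x by q and expands y by
   1 / q, and v = x + y is contracted by q. *)
Lemma expanded_part_le (R : realType) (q a v x y Lv Lx Ly : R) :
  0 < q -> q ^+ 2 <= 1 / 2 -> 0 <= y -> v <= a -> Lv <= q * a -> Lx <= q * x ->
  y <= q * Ly -> x <= v + y -> Ly <= Lv + Lx -> y <= 4 * q ^+ 2 * a.
Proof.
move=> q0 q2 y0 va Lva Lxx yLy xvy LyLv.
have h1 : q * Ly <= q * (q * a + q * x) by rewrite ler_pM2l //; lra.
have h2 : q ^+ 2 * x <= q ^+ 2 * (a + y) by rewrite ler_pM2l ?exprn_gt0 //; lra.
have h3 : q ^+ 2 * y <= 1 / 2 * y by rewrite ler_wpM2r.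
have h4 : q * (q * a + q * x) = q ^+ 2 * a + q ^+ 2 * x by ring.
lra.
Qed.

Lemma linfun_tangent_map (R : realType) (n : nat) (M : closed_manifold R n)
    (F : M -> M) (x : M) v : linfun (tangent_map F x) v = tangent_map F x v.
Proof. by rewrite /tangent_map lfunE. Qed.

Section Splittings.
Context {R : realType} {n : nat} (M : closed_manifold R n).
Context (g : riemannian_metric M) (f : M -> M) (f_diffeo : C1_local_diffeo f).
Implicit Types (x y : M) (xs ys : int -> M).

Lemma diffeo_C1_at x : C1_at f x.
Proof.
have [U [h [oU Ux _ _ [fC _]]]] := f_diffeo x; exact: manifold_C1_at oU Ux fC.
Qed.

Lemma diffeo_local_inverse x : exists h : M -> M, [/\ C1_at h (f x),
  (\forall y \near x, h (f y) = y) & (\forall z \near f x, f (h z) = z)].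
Proof.
have [U [h [oU Ux ofU hf [_ hC]]]] := f_diffeo x; exists h; split.
- by apply: (manifold_C1_at ofU _ hC); exists x.
- by apply: filterS (open_nbhs_nbhs (conj oU Ux)) => y; exact: hf.
- have : nbhs (f x) (f @` U) by apply: open_nbhs_nbhs; split=> //; exists x.
  by apply: filterS => _ [y Uy <-]; rewrite hf.
Qed.

Lemma diffeo_continuous x : {for x, continuous f}.
Proof. exact: (nbhs_singleton (diffeo_C1_at x).1).1. Qed.

Lemma C1_at_iter k x : C1_at (iter k f) x.
Proof.
elim: k => [|k IH]; first exact: C1_at_id.
exact: (C1_at_comp (F := iter k f) (G := f) IH (diffeo_C1_at _)).
Qed.

Lemma differentiable_at_iter k x : differentiable_at (iter k f) x.
Proof. exact: nbhs_singleton (C1_at_iter k x).1. Qed.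

Lemma tangent_map_iterS k x v : tangent_map (iter k.+1 f) x v =
  tangent_map f (iter k f x) (tangent_map (iter k f) x v).
Proof.
apply: (@tangent_map_comp _ _ _ (iter k f) f).
  exact: differentiable_at_iter.
exact: (differentiable_at_iter 1).
Qed.

(** By the chain rule, the tangent map of a local inverse is a left inverse. *)
Lemma tangent_map_inj x : injective (tangent_map f x).
Proof.
have [h [hC hf _]] := diffeo_local_inverse x => u v uv.
have E w : tangent_map h (f x) (tangent_map f x w) = w.
  rewrite -[RHS](tangent_map_id x) -tangent_map_comp.
  - apply: near_eq_tangent_map; first exact: hf.
    apply: differentiable_at_comp (differentiable_at_iter 1 x) _.
    exact: nbhs_singleton hC.1.
  - exact: (differentiable_at_iter 1).
  - exact: nbhs_singleton hC.1.
by rewrite -(E u) uv E.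
Qed.

Lemma tangent_map_iter_inj k x : injective (tangent_map (iter k f) x).
Proof.
elim: k => [|k IH] u v; first by rewrite !(tangent_map_id x).
by rewrite !tangent_map_iterS => /tangent_map_inj/IH.
Qed.

Lemma orbit_iter xs k i : is_orbit f xs -> iter k f (xs i) = xs (i + k%:Z).
Proof.
move=> oxs; elim: k => [|k IH]; first by rewrite addr0.
by rewrite /= IH oxs -addrA -PoszD addn1.
Qed.

Lemma orbit_shift xs j : is_orbit f xs -> is_orbit f (fun i => xs (i + j)).
Proof. by move=> oxs i; rewrite oxs addrAC. Qed.

Section Invariant.
Context (xs : int -> M) (E : int -> {vspace 'rV[R]_n}) (oxs : is_orbit f xs).
Context (E_inv : forall i, (linfun (tangent_map f (xs i)) @: E i)%VS = E (i + 1)).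

Lemma invariant_iter k i v : v \in E i ->
  tangent_map (iter k f) (xs i) v \in E (i + k%:Z).
Proof.
move=> vE; elim: k => [|k IH]; first by rewrite (tangent_map_id (xs i)) addr0.
rewrite tangent_map_iterS orbit_iter // addzS -E_inv.
by rewrite -linfun_tangent_map memv_img.
Qed.

(** Invariance is an equality of images, so vectors of [E] can be pulled back along the orbit. This
    stands for negative iterates of the derivative, [f] having no global inverse. *)
Lemma invariant_iter_preim k i w : w \in E (i + k%:Z) ->
  exists2 v, v \in E i & tangent_map (iter k f) (xs i) v = w.
Proof.
elim: k w => [|k IH] w.
  by rewrite addr0 => wE; exists w => //; exact: tangent_map_id (xs i) _.
rewrite addzS -E_inv => /memv_imgP[u /IH[v vE vu] ->].
exists v => //; rewrite tangent_map_iterS vu orbit_iter //.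
by rewrite linfun_tangent_map.
Qed.

End Invariant.

Section OneSplitting.
Context (C lam : R) (C0 : 0 < C) (lam1 : 1 < lam).
Context (xs : int -> M) (Es Eu : int -> {vspace 'rV[R]_n}) (oxs : is_orbit f xs).
Context (hs : hyperbolic_splitting g f C lam xs Es Eu).

Local Notation q k := (C * lam ^- k).

Lemma rate_gt0 k : 0 < q k.
Proof. by rewrite mulr_gt0 // invr_gt0 exprn_gt0 // (lt_trans _ lam1). Qed.

Lemma splitting_decomp i v : exists s u, [/\ s \in Es i, u \in Eu i & v = s + u].
Proof.
have [vE _] := splitting_direct hs i.
have : v \in (Es i + Eu i)%VS by rewrite vE memvf.
by move=> /memv_addP[s sE [u uE ->]]; exists s, u.
Qed.

Lemma splitting_inj i s u s' u' : s \in Es i -> u \in Eu i -> s' \in Es i ->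
  u' \in Eu i -> s + u = s' + u' -> s = s' /\ u = u'.
Proof.
move=> sE uE s'E u'E E; have E' : s - s' = u' - u.
  by apply/eqP; rewrite subr_eq addrAC -subr_eq opprK E addrC.
have : s - s' \in (Es i :&: Eu i)%VS by rewrite memv_cap memvB //= E' memvB.
have [_ ->] := splitting_direct hs i.
rewrite memv0 => /eqP h; split; first by apply/eqP; rewrite -subr_eq0 h.
by apply/esym/eqP; rewrite -subr_eq0 -E' h.
Qed.

Lemma unstable_norm_le k i u : (0 < k)%N -> u \in Eu i ->
  tangent_norm g (xs i) u <=
  q k * tangent_norm g (xs (i + k%:Z)) (tangent_map (iter k f) (xs i) u).
Proof.
move=> k0 uE; have := splitting_expands hs k0 uE.
have lk : 0 < lam ^+ k by rewrite exprn_gt0 // (lt_trans _ lam1).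
rewrite -(orbit_iter k i oxs) -mulrA -ler_pdivlMl ?invr_gt0 // invrK.
by rewrite -ler_pdivlMl // mulrCA mulrA.
Qed.

Lemma stable_norm_le k i s : (0 < k)%N -> s \in Es i ->
  tangent_norm g (xs (i + k%:Z)) (tangent_map (iter k f) (xs i) s) <=
  q k * tangent_norm g (xs i) s.
Proof.
by move=> k0 sE; rewrite -(orbit_iter k i oxs) (splitting_contracts hs k0 sE).
Qed.

(** By [expanded_part_le] for the derivative of [iter k f]: a vector contracted as if it were stable
    cannot have a large unstable component, which would be expanded. *)
Lemma unstable_part_le k i a v s u : (0 < k)%N -> q k ^+ 2 <= 1 / 2 ->
  tangent_norm g (xs i) v <= a ->
  tangent_norm g (iter k f (xs i)) (tangent_map (iter k f) (xs i) v) <= q k * a ->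
  s \in Es i -> u \in Eu i -> v = s + u ->
  tangent_norm g (xs i) u <= 4 * q k ^+ 2 * a.
Proof.
move=> k0 q2 va Lva sE uE vsu; rewrite (orbit_iter k i oxs) in Lva.
apply: (expanded_part_le (rate_gt0 k) q2 (tangent_norm_ge0 _ _ _) va Lva
  (stable_norm_le k0 sE) (unstable_norm_le k0 uE)).
  have -> : s = v - u by rewrite vsu addrK.
  exact: tangent_normB.
have -> : tangent_map (iter k f) (xs i) u =
    tangent_map (iter k f) (xs i) v - tangent_map (iter k f) (xs i) s.
  by rewrite vsu tangent_mapD addrC addKr.
exact: tangent_normB.
Qed.

(** Time reversal of [unstable_part_le]: the map in [expanded_part_le] now takes [v] back to [z],
    contracting unstable vectors and expanding stable ones. *)
Lemma stable_part_le k i a v z s u : (0 < k)%N -> q k ^+ 2 <= 1 / 2 ->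
  tangent_norm g (xs (i + k%:Z)) v <= a -> tangent_norm g (xs i) z <= q k * a ->
  tangent_map (iter k f) (xs i) z = v ->
  s \in Es (i + k%:Z) -> u \in Eu (i + k%:Z) -> v = s + u ->
  tangent_norm g (xs (i + k%:Z)) s <= 4 * q k ^+ 2 * a.
Proof.
move=> k0 q2 va za zv sE uE vsu.
have [s' s'E s's] := invariant_iter_preim oxs (splitting_s_invariant hs) sE.
have [u' u'E u'u] := invariant_iter_preim oxs (splitting_u_invariant hs) uE.
have zsu : z = s' + u'.
  apply: (@tangent_map_iter_inj k (xs i)).
  by rewrite zv tangent_mapD s's u'u.
have us := unstable_norm_le k0 u'E; have ss := stable_norm_le k0 s'E.
rewrite u'u in us; rewrite s's in ss.
apply: (expanded_part_le (rate_gt0 k) q2 (tangent_norm_ge0 _ _ _) va za us ss).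
  have -> : u = v - s by rewrite vsu addrC addKr.
  exact: tangent_normB.
have -> : s' = z - u' by rewrite zsu addrK.
exact: tangent_normB.
Qed.

End OneSplitting.

End Splittings.

(** * Uniqueness of the hyperbolic splitting *)

Section Uniqueness.
Context {R : realType} {n : nat} (M : closed_manifold R n).
Context (g : riemannian_metric M) (f : M -> M) (f_diffeo : C1_local_diffeo f).
Implicit Types (x y : M) (xs ys : int -> M).

Lemma splitting_weaken C C' lam lam' xs Es Eu : 0 < C -> C <= C' ->
  1 < lam' -> lam' <= lam ->
  hyperbolic_splitting g f C lam xs Es Eu ->
  hyperbolic_splitting g f C' lam' xs Es Eu.
Proof.
move=> C0 CC' l1 ll' [dir si ui ex co].
have l0 : 0 < lam' by exact: lt_trans l1.
have C'0 : 0 < C' by exact: lt_le_trans CC'.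
have pw k : lam' ^+ k <= lam ^+ k.
  by rewrite lerXn2r // nnegrE ltW // (lt_le_trans l0).
split=> // [k i v k0 vE|k i v k0 vE].
  apply: le_trans (ex k i v k0 vE); apply: ler_wpM2r; first exact: tangent_norm_ge0.
  apply: ler_pM; [by rewrite invr_ge0 ltW|by rewrite exprn_ge0 // ltW| |exact: pw].
  by rewrite lef_pV2.
apply: le_trans (co k i v k0 vE) _; apply: ler_wpM2r; first exact: tangent_norm_ge0.
have lk : 0 < lam ^+ k by rewrite exprn_gt0 // (lt_le_trans l0).
have lk' : 0 < lam' ^+ k by rewrite exprn_gt0.
apply: ler_pM => //; first exact: ltW.
  by rewrite invr_ge0 ltW.
by rewrite lef_pV2.
Qed.

Lemma splitting_shift C lam xs Es Eu j :
  hyperbolic_splitting g f C lam xs Es Eu ->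
  hyperbolic_splitting g f C lam (fun i => xs (i + j)) (fun i => Es (i + j))
    (fun i => Eu (i + j)).
Proof.
move=> [dir si ui ex co]; split=> [i|i|i|k i v|k i v].
- exact: dir.
- by rewrite si addrAC.
- by rewrite ui addrAC.
- exact: ex.
- exact: co.
Qed.

Lemma le0_small (b : R) : (forall e, 0 < e -> b <= e) -> b <= 0.
Proof.
move=> h; rewrite leNgt; apply/negP => b0.
have := h (b / 2); rewrite divr_gt0 // => /(_ isT); lra.
Qed.

(** Forward contraction is decided by the base point, so sharing [xs 0] is enough. The component in
    [Fu 0] of a vector of [Es 0] has norm below every [e]. *)
Lemma common_stable_sub C lam xs ys Es Eu Fs Fu : 0 < C -> 1 < lam ->
  is_orbit f xs -> is_orbit f ys -> xs 0 = ys 0 ->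
  hyperbolic_splitting g f C lam xs Es Eu ->
  hyperbolic_splitting g f C lam ys Fs Fu -> (Es 0%R <= Fs 0%R)%VS.
Proof.
move=> C0 l1 oxs oys xy hx hy; apply/subvP => v vE.
have [s [u [sF uF vsu]]] := splitting_decomp hy 0 v.
suff u0 : u = 0 by rewrite vsu u0 addr0.
apply: (tangent_norm0_eq0 (g := g) (x := ys 0)); apply/eqP.
rewrite eq_le tangent_norm_ge0 andbT.
apply: le0_small => e e0.
have [k [k0 q2 qe]] :=
  exists_expV_sqr_le C0 l1 (tangent_norm_ge0 g (ys 0) v) e0.
apply: le_trans qe.
apply: (unstable_part_le C0 l1 oys hy k0 q2 (lexx _) _ sF uF vsu).
by rewrite -xy; exact: splitting_contracts hx _ _ _ k0 vE.
Qed.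

(** Here the past matters: vectors are pulled back to time [- k], so both splittings are taken along
    one orbit. *)
Lemma common_unstable_sub C lam xs Es Eu Fs Fu : 0 < C -> 1 < lam ->
  is_orbit f xs -> hyperbolic_splitting g f C lam xs Es Eu ->
  hyperbolic_splitting g f C lam xs Fs Fu -> (Eu 0%R <= Fu 0%R)%VS.
Proof.
move=> C0 l1 oxs hx hy; apply/subvP => v vE.
have [s [u [sF uF vsu]]] := splitting_decomp hy 0 v.
suff s0 : s = 0 by rewrite vsu s0 add0r.
apply: (tangent_norm0_eq0 (g := g) (x := xs 0)); apply/eqP.
rewrite eq_le tangent_norm_ge0 andbT.
apply: le0_small => e e0.
have [k [k0 q2 qe]] :=
  exists_expV_sqr_le C0 l1 (tangent_norm_ge0 g (xs 0) v) e0.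
apply: le_trans qe.
have E : - k%:Z + k%:Z = 0%R by rewrite addNr.
rewrite -E in vE sF uF.
have [z zE zv] := invariant_iter_preim f_diffeo oxs (splitting_u_invariant hx) vE.
have zn := unstable_norm_le C0 l1 oxs hx k0 zE; rewrite zv in zn.
have := stable_part_le f_diffeo C0 l1 oxs hy k0 q2 (lexx _) zn zv sF uF vsu.
by rewrite E.
Qed.

Lemma splitting_unique C lam C' lam' xs ys Es Eu Fs Fu :
  0 < C -> 1 < lam -> 0 < C' -> 1 < lam' ->
  is_orbit f xs -> is_orbit f ys ->
  hyperbolic_splitting g f C lam xs Es Eu ->
  hyperbolic_splitting g f C' lam' ys Fs Fu ->
  (xs 0 = ys 0 -> Es 0 = Fs 0) /\ (xs = ys -> Eu 0 = Fu 0).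
Proof.
move=> C0 l1 C'0 l1' oxs oys hx hy.
have [m [l [m0 ll hx' hy']]] : exists m l, [/\ 0 < m, 1 < l,
    hyperbolic_splitting g f m l xs Es Eu & hyperbolic_splitting g f m l ys Fs Fu].
  (* The larger constant and the smaller rate serve both splittings. *)
  exists (Num.max C C'), (Num.min lam lam'); split.
  - by rewrite lt_max C0.
  - by rewrite lt_min l1.
  - by apply: (splitting_weaken C0 _ _ _ hx);
      rewrite ?le_max ?lexx ?lt_min ?l1 // ge_min lexx.
  - by apply: (splitting_weaken C'0 _ _ _ hy);
      rewrite ?le_max ?lexx ?orbT ?lt_min ?l1 // ge_min lexx orbT.
split=> [xy|E].
  apply/eqP; rewrite eqEsubv; apply/andP; split.
    exact: (common_stable_sub m0 ll oxs oys xy hx' hy').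
  exact: (common_stable_sub m0 ll oys oxs (esym xy) hy' hx').
move: hy'; rewrite -E => hy'.
apply/eqP; rewrite eqEsubv; apply/andP; split.
  exact: (common_unstable_sub m0 ll oxs hx' hy').
exact: (common_unstable_sub m0 ll oxs hy' hx').
Qed.

End Uniqueness.

(** * Inverse branches along an orbit *)

Section Branches.
Context {R : realType} {n : nat} (M : closed_manifold R n).
Context (f : M -> M) (f_diffeo : C1_local_diffeo f).
Context (f_surj : forall y, exists z, f z = y).
Implicit Types (x y : M) (xs ys : int -> M).

(* The k-th map of the family is an inverse branch of f which sends xs (- k) to
   xs (- (k + 1)), made total by choosing arbitrary preimages away from xs (- k). *)
Definition backward_branches xs (h : nat -> M -> M) : Prop :=
  forall k, [/\ forall z, f (h k z) = z,
    h k (xs (- k%:Z)) = xs (- k.+1%:Z), C1_at (h k) (xs (- k%:Z)) &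
    \forall z \near xs (- k.+1%:Z), h k (f z) = z].

Lemma orbitN xs k : is_orbit f xs -> f (xs (- k.+1%:Z)) = xs (- k%:Z).
Proof.
by move=> oxs; rewrite oxs -addn1 PoszD opprD addrNK.
Qed.

Lemma exists_backward_branches xs : is_orbit f xs ->
  exists h, backward_branches xs h.
Proof.
move=> oxs; suff /choice[h hP] : forall k : nat, exists h : M -> M,
    [/\ forall z, f (h z) = z,
    h (xs (- k%:Z)) = xs (- k.+1%:Z), C1_at h (xs (- k%:Z)) &
    \forall z \near xs (- k.+1%:Z), h (f z) = z] by exists h.
move=> k; set x := xs (- k.+1%:Z).
have fx : f x = xs (- k%:Z) by exact: orbitN.
have [h [hC hf fh]] := diffeo_local_inverse f_diffeo x.
have [pre preP] := choice f_surj.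
(* Falling back on an arbitrary preimage makes [h'] a section of [f] everywhere, with the germ of
   [h] at [f x]. *)
pose h' z := if `[< f (h z) = z >] then h z else pre z.
have hh' : {near f x, h =1 h'}.
  by apply: filterS fh => z fhz; rewrite /h' asboolT.
have h'f : \forall y \near x, h' (f y) = y.
  have cf : {for x, continuous f} by exact: diffeo_continuous.
  by apply: filterS2 hf (cf _ hh') => y hfy /= <-.
exists h'; split.
- by move=> z; rewrite /h'; case: asboolP.
- by rewrite -fx; exact: nbhs_singleton h'f.
- by rewrite -fx; exact: near_eq_C1_at hh' hC.
- exact: h'f.
Qed.

Fixpoint pullback (h : nat -> M -> M) (k : nat) : M -> M :=
  if k is k'.+1 then h k' \o pullback h k' else id.

(** [Negz k] is the time [-(k + 1)], hence [pullback h k.+1]. As backward branches are sections of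
    [f], they yield an orbit for every [y], not only near [xs 0]. *)
Definition nearby_orbit (h : nat -> M -> M) (y : M) (i : int) : M :=
  match i with Posz k => iter k f y | Negz k => pullback h k.+1 y end.

Context (xs : int -> M) (oxs : is_orbit f xs) (h : nat -> M -> M).
Context (hP : backward_branches xs h).

Lemma iter_pullback k y : iter k f (pullback h k y) = y.
Proof. by elim: k => //= k IH; rewrite -iterS iterSr /=; have [-> _ _ _] := hP k. Qed.

Lemma pullback_orbit k : pullback h k (xs 0) = xs (- k%:Z).
Proof. by elim: k => [|k /= ->] //; have [_ -> _ _] := hP k. Qed.

Lemma C1_at_pullback k : C1_at (pullback h k) (xs 0).
Proof.
elim: k => [|k IH]; first exact: C1_at_id.
apply: (C1_at_comp (F := pullback h k) (G := h k) IH).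
by rewrite pullback_orbit; have [_ _ ? _] := hP k.
Qed.

(** Near [xs (- k.+1%:Z)] the branch [h k] inverts [f], so orbits converging to [xs] must eventually
    take that branch. How soon depends on the depth [k]. *)
Lemma near_pullback (T : Type) (F : set_system T) (xs' : T -> int -> M) k :
  Filter F -> (\forall t \near F, is_orbit f (xs' t)) ->
  (forall i : int, xs' t i @[t --> F] --> xs i) ->
  \forall t \near F, xs' t (- k%:Z) = pullback h k (xs' t 0).
Proof.
move=> FF o' cv; elim: k => [|k IH]; first by apply: nearW.
have [_ _ _ hf] := hP k.
have hf' : \forall t \near F, h k (f (xs' t (- k.+1%:Z))) = xs' t (- k.+1%:Z).
  exact: (cv (- k.+1%:Z) _ hf).
apply: filterS3 o' IH hf' => t ot IHt ht.
by rewrite /= -IHt -(orbitN k ot).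
Qed.

Lemma nearby_orbitP y : is_orbit f (nearby_orbit h y).
Proof.
case=> [k|[|k]].
- by rewrite -PoszD addn1.
- by rewrite /=; have [-> _ _ _] := hP 0.
have -> : Negz k.+1 + 1 = Negz k by rewrite !NegzE -addn1 PoszD opprD addrNK.
by rewrite /=; have [-> _ _ _] := hP k.+1.
Qed.

Lemma cvg_nearby_orbit i : nearby_orbit h y i @[y --> xs 0] --> xs i.
Proof.
case: i => k.
  rewrite -[Posz k]add0r -(orbit_iter k 0 oxs).
  exact: (differentiable_at_iter f_diffeo k (xs 0)).1.
rewrite NegzE -pullback_orbit.
exact: (nbhs_singleton (C1_at_pullback k.+1).1).1.
Qed.

End Branches.

(** * Continuity of the unstable space *)

Section Continuity.
Context {R : realType} {n : nat} (M : closed_manifold R n).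
Context (g : riemannian_metric M) (f : M -> M) (f_diffeo : C1_local_diffeo f).
Context (f_surj : forall y, exists z, f z = y).
Context (C lam : R) (C0 : 0 < C) (lam1 : 1 < lam).
Context (Es Eu : (int -> M) -> int -> {vspace 'rV[R]_n}).
Context (split : forall xs, is_orbit f xs ->
  hyperbolic_splitting g f C lam xs (Es xs) (Eu xs)).

Section Limit.
Context (T : Type) (F : set_system T) (FF : Filter F) (xs' : T -> int -> M).
Context (oxs' : \forall t \near F, is_orbit f (xs' t)).
Context (xs : int -> M) (oxs : is_orbit f xs).
Context (cv : forall i : int, xs' t i @[t --> F] --> xs i).

Let tau t := chart_transport (xs 0) (xs' t 0).

Lemma near_transported_norm_lt (G : M -> M) v b : C1_at G (xs 0) ->
  tangent_norm g (G (xs 0)) (tangent_map G (xs 0) v) < b ->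
  \forall t \near F,
    tangent_norm g (G (xs' t 0)) (tangent_map G (xs' t 0) (tau t v)) < b.
Proof.
move=> GC vb; have L := cvg_tangent_norm (g := g) (v := v) GC.
have h : \forall y \near xs 0, tangent_norm g (G y)
    (tangent_map G y (chart_transport (xs 0) y v)) < b by exact: cvgr_lt L _ vb.
exact: (@cv 0 _ h).
Qed.

Lemma near_transported_norm_gt v b : b < tangent_norm g (xs 0) v ->
  \forall t \near F, b < tangent_norm g (xs' t 0) (tau t v).
Proof.
move=> vb; have L := cvg_tangent_norm (g := g) (v := v) (C1_at_id (xs 0)).
rewrite tangent_map_id in L.
have h : \forall y \near xs 0, b < tangent_norm g (id y)
    (tangent_map id y (chart_transport (xs 0) y v)) by exact: cvgr_gt L _ vb.
have h' : \forall t \near F, b < tangent_norm g (xs' t 0)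
    (tangent_map id (xs' t 0) (tau t v)) by exact: (@cv 0 _ h).
by apply: filterS h' => t; rewrite tangent_map_id.
Qed.

Lemma near_transported_norm_le v :
  \forall t \near F,
    tangent_norm g (xs' t 0) (tau t v) <= tangent_norm g (xs 0) v + 1.
Proof.
have h : tangent_norm g (xs 0) (tangent_map id (xs 0) v) <
         tangent_norm g (xs 0) v + 1 by rewrite tangent_map_id ltrDl.
apply: filterS (near_transported_norm_lt (C1_at_id (xs 0)) h) => t.
by rewrite tangent_map_id => /ltW.
Qed.

(** The derivative of the depth-[k] inverse branch contracts [v]. Being a strict inequality on a C1
    map, this persists at nearby points, and nearby orbits use the same branch; [stable_part_le]
    concludes. *)
Lemma near_stable_part_le v e : v \in Eu xs 0 -> 0 < e ->
  \forall t \near F, forall s u, s \in Es (xs' t) 0 -> u \in Eu (xs' t) 0 ->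
    tau t v = s + u -> tangent_norm g (xs' t 0) s <= e.
Proof.
(* The [+ 1] makes the bounds strict, leaving room for the perturbation. *)
move=> vE e0; set a := tangent_norm g (xs 0) v + 1.
have a0 : 0 <= a by rewrite addr_ge0 // tangent_norm_ge0.
have [k [k0 q2 qe]] := exists_expV_sqr_le C0 lam1 a0 e0.
have q0 := rate_gt0 C0 lam1 k; set q := C * lam ^- k in q2 qe q0.
have E : - k%:Z + k%:Z = 0%R by rewrite addNr.
have [h hP] := exists_backward_branches f_diffeo f_surj oxs.
have GC := C1_at_pullback hP k.
have Gf y w : differentiable_at (pullback h k) y ->
    tangent_map (iter k f) (pullback h k y) (tangent_map (pullback h k) y w) = w.
  move=> dG; have df := differentiable_at_iter f_diffeo k (pullback h k y).
  transitivity (tangent_map (iter k f \o pullback h k) y w).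
    exact: esym (tangent_map_comp w dG df).
  transitivity (tangent_map id y w); last exact: tangent_map_id.
  apply: near_eq_tangent_map (differentiable_at_comp dG df).
  by apply: nearW => z; exact: iter_pullback hP k z.
have Gv : tangent_norm g (pullback h k (xs 0))
    (tangent_map (pullback h k) (xs 0) v) < q * a.
  have := vE; rewrite -{1}E => vE'.
  have [z zE zv] :=
    invariant_iter_preim f_diffeo oxs (splitting_u_invariant (split oxs)) vE'.
  have -> : tangent_map (pullback h k) (xs 0) v = z.
    apply: (@tangent_map_iter_inj _ _ _ _ f_diffeo k (xs (- k%:Z))).
    rewrite zv -(pullback_orbit hP) Gf //.
    exact: nbhs_singleton GC.1.
  rewrite (pullback_orbit hP).
  apply: le_lt_trans (unstable_norm_le C0 lam1 oxs (split oxs) k0 zE) _.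
  by rewrite zv E ltr_pM2l // ltrDl.
have n1 := near_transported_norm_lt GC Gv.
have n2 := near_transported_norm_le v.
have n3 := near_pullback hP k FF oxs' cv.
have n4 : \forall t \near F, differentiable_at (pullback h k) (xs' t 0).
  exact: (@cv 0 _ GC.1).
near=> t; move=> s u sE uE tsu.
have ot : is_orbit f (xs' t) by near: t.
have Gt : xs' t (- k%:Z) = pullback h k (xs' t 0) by near: t.
have dt : differentiable_at (pullback h k) (xs' t 0) by near: t.
apply: le_trans qe; rewrite -E in sE uE.
have va : tangent_norm g (xs' t (- k%:Z + k%:Z)) (tau t v) <= a.
  by rewrite E; near: t.
have za : tangent_norm g (xs' t (- k%:Z))
    (tangent_map (pullback h k) (xs' t 0) (tau t v)) <= q * a.
  by rewrite Gt ltW //; near: t.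
have zv : tangent_map (iter k f) (xs' t (- k%:Z))
    (tangent_map (pullback h k) (xs' t 0) (tau t v)) = tau t v.
  by rewrite Gt Gf.
have := stable_part_le f_diffeo C0 lam1 ot (split ot) k0 q2 va za zv sE uE tsu.
by rewrite E.
Unshelve. all: by end_near. Qed.

Lemma near_unstable_part_le v e : v \in Es xs 0 -> 0 < e ->
  \forall t \near F, forall s u, s \in Es (xs' t) 0 -> u \in Eu (xs' t) 0 ->
    tau t v = s + u -> tangent_norm g (xs' t 0) u <= e.
Proof.
move=> vE e0; set a := tangent_norm g (xs 0) v + 1.
have a0 : 0 <= a by rewrite addr_ge0 // tangent_norm_ge0.
have [k [k0 q2 qe]] := exists_expV_sqr_le C0 lam1 a0 e0.
have q0 := rate_gt0 C0 lam1 k; set q := C * lam ^- k in q2 qe q0.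
have fv : tangent_norm g (iter k f (xs 0)) (tangent_map (iter k f) (xs 0) v) < q * a.
  apply: le_lt_trans (splitting_contracts (split oxs) k0 vE) _.
  by rewrite ltr_pM2l // ltrDl.
have n1 := near_transported_norm_lt (C1_at_iter f_diffeo k (xs 0)) fv.
have n2 := near_transported_norm_le v.
near=> t; move=> s u sE uE tsu.
have ot : is_orbit f (xs' t) by near: t.
apply: le_trans qe.
have va : tangent_norm g (xs' t 0) (tau t v) <= a by near: t.
apply: (unstable_part_le C0 lam1 ot (split ot) k0 q2 va _ sE uE tsu).
by rewrite ltW //; near: t.
Unshelve. all: by end_near. Qed.

End Limit.

Lemma stable_eq xs ys : is_orbit f xs -> is_orbit f ys -> xs 0 = ys 0 ->
  Es xs 0 = Es ys 0.
Proof.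
move=> ox oy; exact: (splitting_unique f_diffeo C0 lam1 C0 lam1 ox oy
  (split ox) (split oy)).1.
Qed.

(** Split [v] in [Eu xs 0] as [s + u] along [ys]. At nearby times [t] the transports of [v] and [u]
    are almost unstable and that of [s] almost stable, for the splitting common to [xs' t] and
    [ys' t]. So the transport of [s] is small, and [s = 0]. *)
Lemma limit_unstable_sub (T : Type) (F : set_system T) (xs' ys' : T -> int -> M)
    (xs ys : int -> M) : ProperFilter F ->
  (\forall t \near F, [/\ is_orbit f (xs' t), is_orbit f (ys' t),
     xs' t 0 = ys' t 0 & Eu (xs' t) 0 = Eu (ys' t) 0]) ->
  is_orbit f xs -> is_orbit f ys -> xs 0 = ys 0 ->
  (forall i : int, xs' t i @[t --> F] --> xs i) ->
  (forall i : int, ys' t i @[t --> F] --> ys i) ->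
  (Eu xs 0%R <= Eu ys 0%R)%VS.
Proof.
move=> PF near' ox oy xy cx cy; apply/subvP => v vE.
have ox' : \forall t \near F, is_orbit f (xs' t).
  by apply: filterS near' => t [].
have oy' : \forall t \near F, is_orbit f (ys' t).
  by apply: filterS near' => t [].
have [s [u [sE uE vsu]]] := splitting_decomp (split oy) 0 v.
suff s0 : s = 0 by rewrite vsu s0 add0r.
apply: (tangent_norm0_eq0 (g := g) (x := ys 0)); apply/eqP.
rewrite eq_le tangent_norm_ge0 andbT; apply: le0_small => e e0.
(* Four errors add up: the stable parts of [v] and [u], the unstable part of [s], and the change of
   norm under transport. *)
have e4 : 0 < e / 4 by lra.
have FF : Filter F by exact: filter_filter.
have n1 := near_stable_part_le _ ox' ox cx vE e4.
have n2 := near_stable_part_le _ oy' oy cy uE e4.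
have n3 := near_unstable_part_le _ oy' oy cy sE e4.
have vb : tangent_norm g (ys 0) s - e / 4 < tangent_norm g (ys 0) s by lra.
have n4 := near_transported_norm_gt _ cy vb.
have [t [[oxt oyt xyt Et] [m1 [m2 [m3 m4]]]]] :=
  filter_ex (filterI near' (filterI (n1 FF) (filterI (n2 FF)
    (filterI (n3 FF) (n4 FF))))).
have Est := stable_eq oxt oyt xyt; rewrite xy xyt Est Et in m1.
set tau := chart_transport (ys 0) (ys' t 0) in m1 m2 m3 m4.
have [s1 [u1 [s1E u1E v1]]] := splitting_decomp (split oyt) 0 (tau v).
have [s2 [u2 [s2E u2E v2]]] := splitting_decomp (split oyt) 0 (tau u).
have [s3 [u3 [s3E u3E v3]]] := splitting_decomp (split oyt) 0 (tau s).
have E : s1 + u1 = (s3 + s2) + (u3 + u2).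
  by rewrite -v1 vsu /tau chart_transportD -/(tau s) -/(tau u) v2 v3 addrACA.
have [s13 _] := splitting_inj (split oyt) s1E u1E (memvD s3E s2E)
  (memvD u3E u2E) E.
have N1 := m1 _ _ s1E u1E v1; have N2 := m2 _ _ s2E u2E v2.
have N3 := m3 _ _ s3E u3E v3.
have N4 : tangent_norm g (ys' t 0) (tau s) <=
    tangent_norm g (ys' t 0) s3 + tangent_norm g (ys' t 0) u3.
  by rewrite v3 tangent_normD.
have N5 : tangent_norm g (ys' t 0) s3 <=
    tangent_norm g (ys' t 0) s1 + tangent_norm g (ys' t 0) s2.
  have -> : s3 = s1 - s2 by rewrite s13 addrK.
  exact: tangent_normB.
lra.
Qed.

Lemma limit_unstable_eq (T : Type) (F : set_system T) (xs' ys' : T -> int -> M)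
    (xs ys : int -> M) : ProperFilter F ->
  (\forall t \near F, [/\ is_orbit f (xs' t), is_orbit f (ys' t),
     xs' t 0 = ys' t 0 & Eu (xs' t) 0 = Eu (ys' t) 0]) ->
  is_orbit f xs -> is_orbit f ys -> xs 0 = ys 0 ->
  (forall i : int, xs' t i @[t --> F] --> xs i) ->
  (forall i : int, ys' t i @[t --> F] --> ys i) ->
  Eu xs 0 = Eu ys 0.
Proof.
move=> PF near' ox oy xy cx cy; apply/eqP; rewrite eqEsubv; apply/andP; split.
  exact: limit_unstable_sub near' ox oy xy cx cy.
have near'' : \forall t \near F, [/\ is_orbit f (ys' t), is_orbit f (xs' t),
     ys' t 0 = xs' t 0 & Eu (ys' t) 0 = Eu (xs' t) 0].
  by apply: filterS near' => t [].
exact: limit_unstable_sub near'' oy ox (esym xy) cy cx.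
Qed.

End Continuity.

(** * Points with many unstable directions *)

(** An ultrafilter replaces extraction of subsequences: all coordinates of a family of orbits
    converge along it at once, without a diagonal argument. *)
Lemma ultra_compact_cvg (T : Type) (X : topologicalType) (G : set_system T)
    (phi : T -> X) : UltraFilter G -> compact [set: X] ->
  exists l : X, phi @ G --> l.
Proof.
move=> UG cX; have PG : ProperFilter G by exact: ultra_proper.
have [l [_ cl]] := cX (phi @ G) _ filterT.
exists l => B Bl; have [//|GB] := in_ultra_setVsetC (phi @^-1` B) UG.
have [x [nBx Bx]] := cl (~` B) B GB Bl.
by [].
Qed.

(** The resulting filter plays the role of a sequence of counterexamples to [P]. *)
Lemma within_setC_proper (T : Type) (F : set_system T) (P : set T) :
  Filter F -> ~ (\forall t \near F, P t) -> ProperFilter (within (~` P) F).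
Proof.
move=> FF nP; split; last exact: within_filter.
move=> h; apply: nP.
have h' : \forall t \near F, (~` P) t -> False by exact: h.
by apply: filterS h' => t nPt; apply: contrapT.
Qed.

(** * Recurrence of a dense orbit *)

Section DenseOrbit.
Context {R : realType} {n : nat} (M : closed_manifold R n).

Lemma not_open_singleton (x : M) : (0 < n)%N -> ~ open [set x].
Proof.
move=> n0 ox; have cx := chart_at_dom x; set c := chart_at x in cx.
have nx : \forall y \near x, y = x by apply: open_nbhs_nbhs; split.
have nv : \forall v \near chart_map c x, v = chart_map c x.
  apply: filterS2 (near_chart_inv cx nx) (near_chart_img cx) => v vx [_ <-].
  by rewrite vx.
pose w : 'rV[R]_n := const_mx 1.
have hc : {for (0 : R), continuous (fun t : R => chart_map c x + t *: w)}.
  apply: cvgD; first exact: cvg_cst.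
  by apply: cvgZ; [exact: cvg_id|exact: cvg_cst].
have nt : \forall t \near (0 : R), chart_map c x + t *: w = chart_map c x.
  have nv' : nbhs (chart_map c x + 0 *: w) [set v | v = chart_map c x].
    by rewrite scale0r addr0.
  exact: (hc _ nv').
have /nbhs_ballP[e /= e0 he] := nt.
have /he : ball (0 : R) e (e / 2).
  by rewrite /ball /= sub0r normrN gtr0_norm ?divr_gt0 //; lra.
rewrite -[RHS]addr0 => /addrI/rowP/(_ (Ordinal n0)).
by rewrite !mxE mulr1 => h; lra.
Qed.

Context (f : M -> M) (n_gt0 : (0 < n)%N) (x0 : M).
Context (x0_dense : dense [set iter k f x0 | k in [set: nat]]).

(** In positive dimension no point is isolated, so removing [iter m f x0] from [O] leaves a nonempty
    open set, and the visit given by induction is not at time [m]. *)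
Lemma dense_orbit_returns (m : nat) (O : set M) : open O -> O !=set0 ->
  exists2 k, (m <= k)%N & O (iter k f x0).
Proof.
elim: m O => [|m IH] O oO O0.
  by have [z [Oz [k _ kz]]] := x0_dense O0 oO; exists k => //; rewrite kz.
have cm : closed [set iter m f x0].
  apply: accessible_closed_set1; exact: hausdorff_accessible (@carrier_hausdorff _ _ M).
have oO' : open (O `\ iter m f x0) by apply: openI => //; exact: closed_openC.
have [||k mk [Ok km]] := IH (O `\ iter m f x0) => //.
  apply/set0P/negP => /eqP OE.
  have Om z : O z -> z = iter m f x0.
    move=> Oz; apply: contrapT => zm.
    by have : (O `\ iter m f x0) z by []; rewrite OE.
  have [z Oz] := O0.
  apply: (@not_open_singleton (iter m f x0)) => //.
  suff <- : O = [set iter m f x0] by [].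
  apply/seteqP; split=> [y /Om //|y /= ->].
  by rewrite -(Om z Oz).
exists k => //; rewrite ltn_neqAle mk andbT; apply/negP => /eqP E.
by apply: km; rewrite E.
Qed.

(** The image is compact, hence closed; its complement, if nonempty, would be visited at a positive
    time, but positive iterates lie in the image. *)
Lemma dense_orbit_surjective : (forall x, {for x, continuous f}) ->
  forall y, exists z, f z = y.
Proof.
move=> cf y; apply: contrapT => ny.
have cl : closed (f @` [set: M]).
  apply: compact_closed (@carrier_hausdorff _ _ M) _.
  apply: continuous_compact; last exact: carrier_compact.
  by apply: continuous_subspaceT => x; exact: cf.
have [||[//|k] _ h] := @dense_orbit_returns 1 (~` (f @` [set: M])).
- exact: closed_openC.
- by exists y => -[z _ zy]; apply: ny; exists z.
by apply: h; exists (iter k f x0).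
Qed.

End DenseOrbit.

(** * Openness, forward invariance and density of having [k] directions *)

Section ManyDirections.
Context {R : realType} {n : nat} (M : closed_manifold R n).
Context (g : riemannian_metric M) (f : M -> M) (f_diffeo : C1_local_diffeo f).
Context (f_surj : forall y, exists z, f z = y).
Context (C lam : R) (C0 : 0 < C) (lam1 : 1 < lam).
Context (Es Eu : (int -> M) -> int -> {vspace 'rV[R]_n}).
Context (split : forall xs, is_orbit f xs ->
  hyperbolic_splitting g f C lam xs (Es xs) (Eu xs)).

Definition separated_orbits k (xs : 'I_k -> int -> M) (x : M) : Prop :=
  (forall a, is_orbit f (xs a) /\ xs a 0 = x) /\
  (forall a b, a != b -> Eu (xs a) 0 <> Eu (xs b) 0).

Definition many_directions k : set M :=
  [set x | exists xs : 'I_k -> int -> M, separated_orbits xs x].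

Lemma open_many_directions k : open (many_directions k).
Proof.
rewrite openE => x [xs [oxs sep]].
have /choice[h hP] : forall a, exists h, backward_branches f (xs a) h.
  move=> a; have oa := (oxs a).1.
  exact: (exists_backward_branches f_diffeo f_surj oa).
have lo a y : is_orbit f (nearby_orbit f (h a) y) by exact: nearby_orbitP (hP a) y.
have lc a i : nearby_orbit f (h a) y i @[y --> x] --> xs a i.
  have [oa <-] := oxs a; exact: (cvg_nearby_orbit f_diffeo oa (hP a)).
have near_sep a b : a != b ->
    \forall y \near x, Eu (nearby_orbit f (h a) y) 0 <> Eu (nearby_orbit f (h b) y) 0.
  (* Otherwise the two spaces coincide at points accumulating at [x], and [limit_unstable_eq] makes
     them coincide at [x]. *)
  move=> ab; apply: contrapT => /within_setC_proper PF; apply: (sep a b ab).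
  have cw i c : nearby_orbit f (h c) y i @[y --> within _ (nbhs x)] --> xs c i.
    apply: cvg_trans (lc c i); apply: cvg_app; exact: cvg_within.
  apply: (limit_unstable_eq f_diffeo f_surj C0 lam1 split PF
    (xs' := nearby_orbit f (h a)) (ys' := nearby_orbit f (h b))).
  - apply: filterS (near_withinT _ _) => y /= /contrapT E.
    by split.
  - exact: (oxs a).1.
  - exact: (oxs b).1.
  - by rewrite (oxs a).2 (oxs b).2.
  - by move=> i; exact: cw.
  - by move=> i; exact: cw.
have nsep : \forall y \near x, forall a b, a != b ->
    Eu (nearby_orbit f (h a) y) 0 <> Eu (nearby_orbit f (h b) y) 0.
  apply: filter_forall => a; apply: filter_forall => b.
  have [->|ab] := eqVneq a b; first by apply: nearW.
  by apply: filterS (near_sep a b ab).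
apply: filterS nsep => y sepy; exists (fun a => nearby_orbit f (h a) y).
by split.
Qed.

(** [Eu] is chosen separately for each orbit, so its compatibility with shifts rests on
    uniqueness. *)
Lemma unstable_shift xs j : is_orbit f xs ->
  Eu (fun i => xs (i + j)) 0 = Eu xs j.
Proof.
move=> ox; have oj := orbit_shift j ox.
have sj := splitting_shift j (split ox).
have := (splitting_unique f_diffeo C0 lam1 C0 lam1 oj oj (split oj) sj).2 erefl.
by rewrite add0r.
Qed.

(** The derivative of [iter j f] at the common point is injective, so distinct directions stay
    distinct in the future. *)
Lemma unstable_forward_sub xs ys (j : nat) : is_orbit f xs -> is_orbit f ys ->
  xs 0 = ys 0 -> Eu xs j%:Z = Eu ys j%:Z -> (Eu xs 0%R <= Eu ys 0%R)%VS.
Proof.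
move=> ox oy xy E; apply/subvP => v vE.
have := invariant_iter f_diffeo ox (splitting_u_invariant (split ox)) j vE.
rewrite add0r E -[j%:Z]add0r => h.
have [w wE] := invariant_iter_preim f_diffeo oy (splitting_u_invariant (split oy)) h.
by rewrite xy => /(tangent_map_iter_inj f_diffeo) <-.
Qed.

Lemma unstable_forward_inj xs ys (j : nat) : is_orbit f xs -> is_orbit f ys ->
  xs 0 = ys 0 -> Eu xs j%:Z = Eu ys j%:Z -> Eu xs 0 = Eu ys 0.
Proof.
move=> ox oy xy E; apply/eqP; rewrite eqEsubv.
by rewrite (unstable_forward_sub ox oy xy E) (unstable_forward_sub oy ox (esym xy) (esym E)).
Qed.

Lemma separated_orbits_shift k (xs : 'I_k -> int -> M) x (j : nat) :
  separated_orbits xs x ->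
  separated_orbits (fun a i => xs a (i + j%:Z)) (iter j f x).
Proof.
move=> [oxs sep]; split=> [a|a b ab].
  have [oa <-] := oxs a; split; first exact: orbit_shift.
  by rewrite add0r (orbit_iter _ _ oa) add0r.
have [oa xa] := oxs a; have [ob xb] := oxs b.
rewrite !unstable_shift // => E; apply: (sep a b ab).
by apply: unstable_forward_inj E => //; rewrite xa xb.
Qed.

Lemma separated_orbits_add k (xs : 'I_k -> int -> M) ys x :
  separated_orbits xs x -> is_orbit f ys -> ys 0 = x ->
  (forall a, Eu (xs a) 0 <> Eu ys 0) -> many_directions k.+1 x.
Proof.
move=> [oxs sep] oy yx ne.
exists (fun b => oapp xs ys (unlift ord0 b)); split=> [b|b c].
  by case: unliftP => [a _|_] /=; [exact: oxs|].
case: unliftP => [a ->|->]; case: unliftP => [a' ->|->] //=.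
- by move=> aa'; apply: sep; apply: contra aa' => /eqP ->.
- by move=> _ /esym; exact: ne.
Qed.

Lemma many_directions_infinite x :
  (forall m, exists2 k, (m < k)%N & many_directions k x) ->
  infinite_set (unstable_directions g f x).
Proof.
move=> many /finite_seqP[s sE].
have [k sk [xs [oxs sep]]] := many (size s).
have inj : injective (fun a => Eu (xs a) 0).
  by move=> a b ab; apply: contrapT => /eqP /sep.
have : (size [seq Eu (xs a) 0 | a <- enum 'I_k] <= size s)%N.
  apply: uniq_leq_size; first by rewrite map_inj_uniq // enum_uniq.
  move=> _ /mapP[a _ ->].
  suff : unstable_directions g f x (Eu (xs a) 0) by rewrite sE.
  have [oa xa] := oxs a; exists (xs a); split=> //.
  exists C, lam; split=> //; exists (Es (xs a)), (Eu (xs a)); split=> //.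
  exact: split.
by rewrite size_map size_enum_ord leqNgt sk.
Qed.

Context (n_gt0 : (0 < n)%N) (x0 : M).
Context (x0_dense : dense [set iter k f x0 | k in [set: nat]]).

(** The dense orbit enters this open set, and forward invariance keeps it there. *)
Lemma many_directions_tail k : many_directions k !=set0 ->
  exists m, forall j, (m <= j)%N -> many_directions k (iter j f x0).
Proof.
move=> ne; have [m _ [xs xsP]] :=
  dense_orbit_returns n_gt0 x0_dense 0 (open_many_directions k) ne.
exists m => j mj; exists (fun a i => xs a (i + (j - m)%N%:Z)).
by rewrite -(subnK mj) iterD addnK; exact: separated_orbits_shift.
Qed.

Lemma dense_many_directions k : many_directions k !=set0 ->
  dense (many_directions k).
Proof.
move=> /many_directions_tail[m mP] O O0 oO.
have [j mj Oj] := dense_orbit_returns n_gt0 x0_dense m oO O0.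
by exists (iter j f x0); split=> //; exact: mP.
Qed.

End ManyDirections.

(** * From [k] directions to [k + 1] *)

Section Collapse.
Context {R : realType} {n : nat} (M : closed_manifold R n).
Context (g : riemannian_metric M) (f : M -> M) (f_diffeo : C1_local_diffeo f).
Context (f_surj : forall y, exists z, f z = y).
Context (C lam : R) (C0 : 0 < C) (lam1 : 1 < lam).
Context (Es Eu : (int -> M) -> int -> {vspace 'rV[R]_n}).
Context (split : forall xs, is_orbit f xs ->
  hyperbolic_splitting g f C lam xs (Es xs) (Eu xs)).
Context (n_gt0 : (0 < n)%N) (x0 : M).
Context (x0_dense : dense [set iter k f x0 | k in [set: nat]]).

Local Notation many := (many_directions f Eu).

(** The [k] directions pushed forward from [w] exhaust those at [iter j f w]. Hence the direction of
    [zs] is also that of an orbit through [w] at time [- j], whose last [j] steps are prescribed. *)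
Lemma unstable_direction_among k w j zs : ~ many k.+1 (iter j f w) ->
  many k w -> is_orbit f zs -> zs 0 = iter j f w ->
  exists ys, [/\ is_orbit f ys, ys 0 = iter j f w, Eu zs 0 = Eu ys 0 &
    forall i, (i <= j)%N -> ys (- i%:Z) = iter (j - i) f w].
Proof.
move=> nm [ws sep] ozs zsw; apply: contrapT => nys; apply: nm.
have sepj := separated_orbits_shift f_diffeo C0 lam1 split j sep.
apply: (separated_orbits_add sepj ozs zsw) => a E; apply: nys.
have [oa aw] := sepj.1 a; exists (fun i => ws a (i + j%:Z)); split=> // i ij.
have [ob <-] := sep.1 a; rewrite (orbit_iter _ _ ob) add0r.
by rewrite addrC subzn.
Qed.

Lemma many_directions_succ k : (1 < k)%N -> many k !=set0 -> many k.+1 !=set0.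
Proof.
move=> k1 ne; apply: contrapT => /set0P/negP; rewrite negbK => /eqP none.
have nm z : ~ many k.+1 z by move=> mz; have : set0 z by rewrite -none.
have [p [xs [oxs sep]]] := ne.
(* A pair [t] is a point near [p] with the number of steps separating it from some [w] with [k]
   directions. *)
pose P (t : M * nat) := exists2 w, many k w & iter t.2 f w = t.1.
pose F0 := filter_prod (nbhs p) (nbhs \oo).
have PF0 : ~ (\forall t \near F0, (~` P) t).
  move=> [[A B] /= [pA [N _ NB]] AB].
  have [m mP] := many_directions_tail f_diffeo f_surj C0 lam1 split n_gt0 x0_dense ne.
  have [V [oV Vp] VA] : exists2 V, open V /\ V p & V `<=` A.
    by move: pA; rewrite nbhsE => -[V [? ?] ?]; exists V.
  (* A visit after time [m + N] leaves [N] steps to go back while staying in the tail where [many k]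
     holds. *)
  have [j mj Vj] := dense_orbit_returns n_gt0 x0_dense (m + N) oV (ex_intro _ _ Vp).
  have Nj : (N <= j)%N by rewrite (leq_trans _ mj) // leq_addl.
  have : (A `*` B) (iter j f x0, N) by split; [exact: VA|exact: (NB N (leqnn N))].
  move=> /AB; apply; exists (iter (j - N) f x0).
    by apply: mP; rewrite leq_subRL // addnC.
  by rewrite /= -iterD subnKC.
have FF0 : Filter F0 by exact: filter_prod_filter.
have := within_setC_proper FF0 PF0; rewrite setCK => PW.
(* Along [G] the point tends to [p], the number of steps to infinity, and [P] holds. *)
have [G [UG sG]] := ultraFilterLemma PW.
have PG : ProperFilter G by exact: ultra_proper.
have GP : \forall t \near G, P t by apply: sG; exact: withinT.
have GF0 (A : set (M * nat)) : F0 A -> G A.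
  by move=> FA; apply: sG; rewrite /within /=; apply: filterS FA => t At _.
have G1 : t.1 @[t --> G] --> p.
  by move=> A pA; apply: GF0; exists (A, setT); [split=> //; exact: filterT|case=> ? ? []].
have G2 i : \forall t \near G, (i <= t.2)%N.
  apply: GF0; exists (setT, [set j | (i <= j)%N]); last by case=> ? ? [].
  by split; [exact: filterT|exists i].
have /choice[h hP] : forall a, exists h, backward_branches f (xs a) h.
  move=> a; have oa := (oxs a).1.
  exact: (exists_backward_branches f_diffeo f_surj oa).
have /choice[cw cwP] : forall t, exists w, P t -> many k w /\ iter t.2 f w = t.1.
  move=> t; have [[w mw wt]|nP] := pselect (P t); first by exists w.
  by exists p => /nP.
(* The direction of the orbit following [xs a] is also carried by an orbit [zs (t, a)] through
   [cw t]; off [P] the values are arbitrary. *)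
have /choice[zs zsP] : forall ta : (M * nat) * 'I_k, exists ys, P ta.1 ->
    [/\ is_orbit f ys, ys 0 = ta.1.1,
      Eu (nearby_orbit f (h ta.2) ta.1.1) 0 = Eu ys 0 &
      forall i, (i <= ta.1.2)%N -> ys (- i%:Z) = iter (ta.1.2 - i) f (cw ta.1)].
  move=> [t a]; have [Pt|nP] := pselect (P t); last by exists (xs a) => /nP.
  have [mw wt] := cwP t Pt; rewrite /= -wt.
  have [|ys ysP] := @unstable_direction_among k (cw t) t.2
    (nearby_orbit f (h a) (iter t.2 f (cw t))) (@nm _) mw _ erefl.
    exact: nearby_orbitP (hP a) _.
  by exists ys.
(* Nonnegative times are fixed by the common point at time 0; the time [-(i + 1)] is prescribed once
   [i + 1 <= t.2]. *)
have zs_agree a b i : \forall t \near G, zs (t, a) i = zs (t, b) i.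
  case: i => i.
    apply: filterS GP => t Pt.
    have [oa za _ _] := zsP (t, a) Pt; have [ob zb _ _] := zsP (t, b) Pt.
    rewrite -[Posz i]add0r -(orbit_iter i 0 oa) -(orbit_iter i 0 ob).
    by rewrite za zb.
  apply: filterS2 GP (G2 i.+1) => t Pt it; rewrite NegzE.
  have [_ _ _ -> //] := zsP (t, a) Pt; by have [_ _ _ -> //] := zsP (t, b) Pt.
pose a0 : 'I_k := Ordinal (ltnW k1); pose a1 : 'I_k := Ordinal k1.
have /choice[y yP] : forall i, exists l : M, zs (t, a0) i @[t --> G] --> l.
  by move=> i; exact: ultra_compact_cvg (@carrier_compact _ _ M).
have zs_cvg a i : zs (t, a) i @[t --> G] --> y i.
  apply: cvg_trans (yP i); apply: near_eq_cvg; exact: zs_agree.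
have hM := @carrier_hausdorff _ _ M.
have oy : is_orbit f y.
  move=> i; apply: (cvg_unique _ (F := zs (t, a0) (i + 1) @[t --> G])) => //.
    apply: cvg_trans (cvg_comp _ _ (yP i) (diffeo_continuous f_diffeo (x := y i))).
    apply: near_eq_cvg; apply: filterS GP => t Pt /=.
    by have [-> _ _ _] := zsP (t, a0) Pt.
  exact: yP.
have y0 : y 0 = p.
  apply: (cvg_unique _ (F := zs (t, a0) 0 @[t --> G])) => //; first exact: yP.
  apply: (cvg_trans _ G1); apply: near_eq_cvg; apply: filterS GP => t Pt /=.
  by have [_ -> _ _] := zsP (t, a0) Pt.
(* All [zs (t, a)] share the limit [y], so every direction of [p] collapses to that of [y], against
   [1 < k]. *)
have lim a : Eu (xs a) 0 = Eu y 0.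
  apply: (limit_unstable_eq f_diffeo f_surj C0 lam1 split PG
    (xs' := fun t => nearby_orbit f (h a) t.1) (ys' := fun t => zs (t, a))).
  - apply: filterS GP => t Pt; have [oz z0 E _] := zsP (t, a) Pt.
    by split=> //; exact: nearby_orbitP (hP a) _.
  - exact: (oxs a).1.
  - exact: oy.
  - by rewrite (oxs a).2 y0.
  - move=> i; have [oa xa] := oxs a; move: G1; rewrite -xa => G1'.
    have L : nearby_orbit f (h a) z i @[z --> xs a 0] --> xs a i.
      exact: (cvg_nearby_orbit f_diffeo oa (hP a)).
    exact: (cvg_comp fst (fun z => nearby_orbit f (h a) z i) G1' L).
  - by move=> i; exact: zs_cvg.
have a01 : a0 != a1 by [].
by apply: (sep _ _ a01); rewrite !lim.
Qed.

End Collapse.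

(** * The dichotomy *)

Theorem theorem1p4 (R : realType) (n : nat) (M : closed_manifold R n)
    (g : riemannian_metric M) (f : M -> M)
    (f_anosov : anosov_endomorphism g f) (f_transitive : transitive_map f) :
  special g f \/
  exists A : set M, residual A /\
    forall x : M, A x -> infinite_set (unstable_directions g f x).
Proof.
have [f_diffeo [C [lam [C0 lam1 splits]]]] := f_anosov.
have [x0 x0_dense] := f_transitive.
have [sp|nsp] := pselect (special g f); [by left|right].
(* Fix one splitting per orbit, all with the constants [C] and [lam]; sequences that are not orbits
   get zero spaces. *)
have /choice[E EP] : forall xs, exists E : (int -> {vspace 'rV[R]_n}) *
    (int -> {vspace 'rV[R]_n}), is_orbit f xs ->
    hyperbolic_splitting g f C lam xs E.1 E.2.
  move=> xs; have [/splits[Es [Eu h]]|nh] := pselect (is_orbit f xs).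
    by exists (Es, Eu).
  by exists (fun=> 0%VS, fun=> 0%VS) => /nh.
pose Es xs := (E xs).1; pose Eu xs := (E xs).2.
have split xs : is_orbit f xs ->
    hyperbolic_splitting g f C lam xs (Es xs) (Eu xs) by exact: EP.
have [xs [ys [oxs oys xy Exy]]] : exists xs ys, [/\ is_orbit f xs,
    is_orbit f ys, xs 0 = ys 0 & Eu xs 0 <> Eu ys 0].
  apply: contrapT => h; apply: nsp => xs ys ox oy xy X Y.
  move=> [Cx [lx [Cx0 lx1 [Fs [Fu [hF <-]]]]]] [Cy [ly [Cy0 ly1 [Gs [Gu [hG <-]]]]]].
  (* Unstable spaces obtained with other constants agree with the chosen ones. *)
  rewrite (splitting_unique f_diffeo Cx0 lx1 C0 lam1 ox ox hF (split _ ox)).2 //.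
  rewrite (splitting_unique f_diffeo Cy0 ly1 C0 lam1 oy oy hG (split _ oy)).2 //.
  by apply: contrapT => ne; apply: h; exists xs, ys.
(* In dimension 0 all subspaces coincide, contradicting [Exy]. *)
have n_gt0 : (0 < n)%N.
  rewrite lt0n; apply/negP => /eqP n0; apply: Exy; apply/vspaceP => v.
  have -> : v = 0 by apply/rowP => j; have := ltn_ord j; rewrite {2}n0.
  by rewrite !mem0v.
have f_surj := dense_orbit_surjective n_gt0 x0_dense (diffeo_continuous f_diffeo).
(* The induction starts at two directions, provided by [xs] and [ys], because the collapse needs
   [1 < k]. *)
have many k : many_directions f Eu k.+2 !=set0.
  elim: k => [|k IH]; last first.
    exact: (many_directions_succ f_diffeo f_surj C0 lam1 split n_gt0 x0_dense _ IH).
  exists (xs 0), (fun a => if a == ord0 then xs else ys); split=> [a|a b].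
    by case: ifP.
  by case: a b => [[|[|//]] ?] [[|[|//]] ?] //= _; exact: nesym.
exists (\bigcap_k many_directions f Eu k.+2); split.
  exists (fun k => many_directions f Eu k.+2); split=> // k; split.
    exact: (open_many_directions f_diffeo f_surj C0 lam1 split).
  exact: (dense_many_directions f_diffeo f_surj C0 lam1 split n_gt0 x0_dense).
move=> x xU; apply: (many_directions_infinite C0 lam1 split) => m.
by exists m.+2; [exact: leqnSn|exact: xU m I].
Qed.
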